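(* Let $(A_0,A_1)$ be a regular Banach couple, $0<q\le 1$, and let $b\in SV(0,\infty)$ be such that $\|t^{-1/q}b(t)\|_{q,(0,1)}<\infty$. Then, with equivalence of quasi-norms, $$(A_0,A_1)^{K}_{1,q,b}=(A_0^{\sim},A_1^{\sim})^{J}_{1,q,B},$$ where $B(t)=\Big(\int_0^t b(s)^q\,\frac{ds}{s}\Big)^{1/q}=\|s^{-1/q}b(s)\|_{q,(0,t)}$, $t>0$, belongs to the class $SV(0,\infty)$ of slowly varying functions.
   Context: A Banach couple $(A_0,A_1)$ is a compatible couple of Banach spaces (both continuously embedded in a common Hausdorff topological vector space) with $A_0\cap A_1\neq\{0\}$. The couple is regular if $A_0\cap A_1$ is dense in $A_0$ and in $A_1$. $SV(0,\infty)$: a positive Lebesgue measurable function $b$ on $(0,\infty)$ ($0\not\equiv b\not\equiv\infty$) is slowly varying if for each $\varepsilon>0$ the function $t\mapsto t^{\varepsilon}b(t)$ is equivalent to an increasing function and $t\mapsto t^{-\varepsilon}b(t)$ is equivalent to a decreasing function (equivalent: each is bounded by a positive constant times the other). $\|\cdot\|_{q,(c,d)}$ is the $L_q$ (quasi-)norm on $(c,d)$ with respect to Lebesgue measure, so $\|t^{-1/q}b(t)\|_{q,(c,d)}=\big(\int_c^d b(t)^q\,\frac{dt}{t}\big)^{1/q}$. $K$-space: $K(t,f)=K(t,f;A_0,A_1)=\inf\{\|f_0\|_{A_0}+t\|f_1\|_{A_1}: f=f_0+f_1,\ f_i\in A_i\}$, and $(A_0,A_1)^K_{1,q,b}$ consists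 of all $f\in A_0+A_1$ with $\|f\|^K_{1,q,b}=\|t^{-1-\frac1q}b(t)K(t,f)\|_{q,(0,\infty)}<\infty$. $J$-space: $J(t,f;A_0,A_1)=\max\{\|f\|_{A_0},t\|f\|_{A_1}\}$ for $f\in A_0\cap A_1$. For a parameter $B$, $(A_0,A_1)^J_{1,q,B}$ consists of all $f\in A_0+A_1$ having a representation $f=\sum_{k\in\mathbb Z}u_k$ (convergence in $A_0+A_1$), $u_k\in A_0\cap A_1$, with $\big(\sum_{k\in\mathbb Z}(2^{-k}B(2^k)J(2^k,u_k))^q\big)^{1/q}<\infty$; its quasi-norm is the infimum of these quantities over all such representations. Gagliardo completion: $A_k^{\sim}$ ($k=0,1$) is the set of all $a\in A_0+A_1$ that are limits in $A_0+A_1$ of some sequence bounded in $A_k$, with norm $\|a\|_{A_k^{\sim}}=\inf\{\sup_n\|a_n\|_{A_k}: \|a_n-a\|_{A_0+A_1}\to0\}$. *)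

(* Defs.v *)
From HB Require Import structures.
From mathcomp Require Import all_boot all_order all_algebra.
From mathcomp Require Import all_classical all_reals all_analysis.
From mathcomp Require Import measurable_realfun.

Set Implicit Arguments.
Unset Strict Implicit.
Unset Printing Implicit Defensive.

Import Order.TTheory GRing.Theory Num.Theory.
Import numFieldTopology.Exports numFieldNormedType.Exports.

Local Open Scope classical_set_scope.
Local Open Scope ring_scope.

(* The line with its Lebesgue (not Borel) measurable sets, i.e. the domain of
   [completed_lebesgue_measure]. *)
Notation lebesgueType R := (caratheodory_type ((wlength (@idfun R))^*)%mu).

Section slow_variation.
Context {R : realType}.
Implicit Types (b f g : R -> \bar R) (q t e : R) (D : set R).
Local Open Scope ereal_scope.

Definition Lq_norm q D g : \bar R :=
  'N[@completed_lebesgue_measure R]_(q%:E)[g \_ D].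

Definition equivalent f g : Prop :=
  exists2 c : R, (0 < c)%R & forall t, (0 < t)%R ->
    f t <= c%:E * g t /\ g t <= c%:E * f t.

(* Functions on (0, +oo) are total functions whose values off (0, +oo) are
   ignored.  That b is not identically 0 is part of [sv_gt0].  "Increasing" and
   "decreasing" are meant in the non-strict sense. *)
Record slowly_varying b : Prop := SlowlyVarying {
  sv_measurable : measurable_fun (`]0%R, +oo[ : set (lebesgueType R))
    b;
  sv_gt0 : forall t, (0 < t)%R -> 0 < b t;
  sv_neqy : exists2 t, (0 < t)%R & b t != +oo;
  sv_increasing : forall e, (0 < e)%R -> exists2 g,
    {in `]0%R, +oo[ &, {homo g : s t / (s <= t)%R >-> s <= t}} &
    equivalent (fun t => (t `^ e)%:E * b t) g;
  sv_decreasing : forall e, (0 < e)%R -> exists2 g,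
    {in `]0%R, +oo[ &, {homo g : s t / (s <= t)%R >-> t <= s}} &
    equivalent (fun t => (t `^ (- e))%:E * b t) g }.

Definition Lq_primitive q b t : \bar R :=
  Lq_norm q `]0%R, t[ (fun s => (s `^ (- q^-1))%:E * b s).

End slow_variation.

Section couples.
Context {R : realType} {V : lmodType R}.
Implicit Types (f a : V) (t : R).

(* A space contained in V together with its (quasi-)norm; the values of [nrm]
   outside of [carrier] are meaningless. *)
Record normed_subset := NormedSubset {
  carrier : set V;
  nrm : V -> R }.

Implicit Types X Y : normed_subset.

Definition same_space_equiv_norms X Y : Prop :=
  carrier X = carrier Y /\
  exists2 c : R, 0 < c & forall f, carrier X f ->
    nrm X f <= c * nrm Y f /\ nrm Y f <= c * nrm X f.

Definition sum_carrier X0 X1 : set V :=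
  [set f | exists f0 f1, [/\ carrier X0 f0, carrier X1 f1 & f = f0 + f1]].

(* Equal to +oo exactly when f is outside of X0 + X1. *)
Definition Kfun X0 X1 t f : \bar R :=
  ereal_inf [set x | exists f0 f1,
    [/\ carrier X0 f0, carrier X1 f1, f = f0 + f1 &
        x = (nrm X0 f0 + t * nrm X1 f1)%:E]].

Definition sum_norm X0 X1 f : \bar R := Kfun X0 X1 1 f.

Definition Jfun X0 X1 t f : R := Num.max (nrm X0 f) (t * nrm X1 f).

Definition Knorm X0 X1 (q : R) (b : R -> \bar R) f : \bar R :=
  Lq_norm q `]0, +oo[
    (fun t => (t `^ (- 1 - q^-1))%:E * b t * Kfun X0 X1 t f)%E.

(* The space (X0, X1)^K_{1,q,b}. *)
Definition K_space X0 X1 q b : normed_subset := {|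
  carrier := [set f | sum_carrier X0 X1 f /\ (Knorm X0 X1 q b f < +oo)%E];
  nrm := fun f => fine (Knorm X0 X1 q b f) |}.

Definition two_sided_partial_sum (u : int -> V) (mn : nat * nat) : V :=
  \sum_(1 <= k < mn.1) u (- k%:Z) + \sum_(0 <= k < mn.2) u k%:Z.

Definition J_representation X0 X1 f (u : int -> V) : Prop :=
  (forall k, carrier X0 (u k) /\ carrier X1 (u k)) /\
  sum_norm X0 X1 (f - two_sided_partial_sum u mn) @[mn --> (\oo, \oo)] --> 0%E.

Definition J_size X0 X1 (q : R) (B : R -> \bar R) (u : int -> V) : \bar R :=
  ((\esum_(k in [set: int])
      (((2 : R) ^ (- k))%:E * B ((2 : R) ^ k) *
       (Jfun X0 X1 ((2 : R) ^ k) (u k))%:E) `^ q) `^ q^-1)%E.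

(* The space (X0, X1)^J_{1,q,B}. *)
Definition J_space X0 X1 q B : normed_subset := {|
  carrier := [set f | sum_carrier X0 X1 f /\
    exists2 u, J_representation X0 X1 f u & (J_size X0 X1 q B u < +oo)%E];
  nrm := fun f =>
    fine (ereal_inf [set J_size X0 X1 q B u | u in J_representation X0 X1 f]) |}.

Definition approximations X0 X1 Y a : set (nat -> V) :=
  [set s | [/\ forall n, carrier Y (s n),
               exists M : R, forall n, nrm Y (s n) <= M &
               sum_norm X0 X1 (s n - a) @[n --> \oo] --> 0%E]].

(* The completion of Y in X0 + X1, to be used with Y := X0 or Y := X1.
   Restricting the infimum to sequences bounded in Y is harmless: the others
   have an infinite supremum. *)
Definition gagliardo X0 X1 Y : normed_subset := {|
  carrier := [set a | sum_carrier X0 X1 a /\ approximations X0 X1 Y a !=set0];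
  nrm := fun a => inf [set sup (range (fun n => nrm Y (s n))) |
                       s in approximations X0 X1 Y a] |}.

End couples.

Arguments normed_subset {R} V.

(* Real scalars: a complex couple is in particular a real one, and none of the
   notions here depends on the scalar field. *)
Section banach_couples.
Context {R : realType} {V : topologicalLmodType R}.

(* The image of A in V, normed so that i is an isometry.  For i injective the
   set below is the singleton of the norm of the preimage of v. *)
Definition embedded (A : normedModType R) (i : A -> V) : normed_subset V := {|
  carrier := range i;
  nrm := fun v => inf [set `|a| | a in i @^-1` [set v]] |}.

Context {A0 A1 : completeNormedModType R}.

Record banach_couple (i0 : {linear A0 -> V}) (i1 : {linear A1 -> V}) : Prop :=
  BanachCouple {
    couple_hausdorff : hausdorff_space V;
    couple_inj0 : injective i0;
    couple_inj1 : injective i1;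
    couple_continuous0 : continuous i0;
    couple_continuous1 : continuous i1;
    couple_nontrivial : range i0 `&` range i1 != [set 0] }.

Definition regular_couple (i0 : {linear A0 -> V}) (i1 : {linear A1 -> V}) :=
  dense (i0 @^-1` range i1) /\ dense (i1 @^-1` range i0).

End banach_couples.

(* Main.v *)
Require Import Defs.
From mathcomp Require Import all_boot all_order all_algebra.
From mathcomp Require Import all_classical all_reals all_analysis.
From mathcomp Require Import measurable_realfun.
From mathcomp Require Import ring lra zify.

(* Write K(t) = K(t, f), psi(t) = K(t) / t and w(t) = b(t)^q / t, so that
   B(t)^q is the integral of w over (0, t) and ||f||_K^q that of w psi^q.

   If f = sum_k u_k in the Gagliardo couple, which has the same K-functional,
   then, as q <= 1, K(t)^q <= sum_k min(1, t / 2^k)^q J(2^k, u_k)^q.  Integrate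
   against t^(-q) w(t), using that the integral of t^(-q) w(t) over (2^k, +oo)
   is at most c 2^(-kq) b(2^k)^q <= c' (2^(-k) B(2^k))^q by slow variation.

   Conversely, regularity gives K(0+) = 0 and psi(+oo) = 0.  Let
   2^(-l(k)) be the dyadic approximation of psi(2^k); as psi is nonincreasing
   and K is nondecreasing, l(k + 1) - l(k) is 0 or 1.  Let u_k vanish unless
   l jumps at k, and otherwise be the difference of near optimal A_0-parts of f
   at the scale 2^k and at the scale of the preceding jump, so that
   J(2^k, u_k) <= 6 2^k 2^(-l(k)).  When there is no preceding jump, psi is
   bounded near 0 and u_k is only in the completion of A_1.  As l takes
   different values at different jumps, the sum of 2^(-q l(k)) over the jumps
   with 2^k > t is at most c psi(t)^q, which integrates to the required bound. *)

Set Implicit Arguments.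
Unset Strict Implicit.
Unset Printing Implicit Defensive.

Import Order.TTheory GRing.Theory Num.Theory.
Import numFieldTopology.Exports numFieldNormedType.Exports.

Local Open Scope classical_set_scope.
Local Open Scope ring_scope.

(** * The K-functional and the Gagliardo completion *)

(** The obvious dyadic choice, differences of A_0-parts of f at consecutive scales, only gives
    J(2^k, u_k) <= c 2^k psi(2^k). As B(2^k)^q is the integral of w over (0, 2^k), exchanging sum
    and integral would then require the sum of psi(2^k)^q over 2^k > t to be bounded by psi(t)^q.
    This fails when psi is nearly constant over many scales, and at the endpoint theta = 1 no power
    of 2^k makes up for it. Keeping only the scales where psi has dropped by about a factor 2 makes
    that sum geometric. It is bounded by telescoping: with lam_k = 2^(-l(k)), the value lam_k^q at a
    jump is a fixed multiple of the increment lam_k^q - lam_(k+1)^q, and the increment is 0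
    elsewhere.

    The levels l(k) need psi > 0 at every scale. If K vanishes at one t > 0, then f has norm zero in
    A_0 + A_1 and the zero family represents it.

    On the weight side, passing from b to B rests on b <= c B, which holds because the integral of w
    over (s/2, s) alone dominates b(s)^q. *)

Section seminormed.
Context {R : realType} {V : lmodType R}.
Implicit Types (X Y : normed_subset V) (f g : V) (t : R).

(** [nrm_ge0] also covers points off the carrier, where the norm is a default value: the norm of
    [embedded] is an infimum, which is 0 over the empty set. *)
Record is_seminormed X : Prop := IsSeminormed {
  carrier0 : carrier X 0;
  carrierB : forall f g, carrier X f -> carrier X g -> carrier X (f - g);
  nrm0 : nrm X 0 = 0;
  nrm_ge0 : forall f, 0 <= nrm X f;
  ler_nrmB : forall f g, carrier X f -> carrier X g ->
    nrm X (f - g) <= nrm X f + nrm X g }.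

Context (X : normed_subset V) (snX : is_seminormed X).

Lemma carrierN f : carrier X f -> carrier X (- f).
Proof. by move=> Xf; rewrite -sub0r; apply: carrierB => //; exact: carrier0. Qed.

Lemma carrierD f g : carrier X f -> carrier X g -> carrier X (f + g).
Proof. by move=> Xf Xg; rewrite -(opprK g); apply: carrierB => //;
  exact: carrierN. Qed.

Lemma nrmN f : carrier X f -> nrm X (- f) = nrm X f.
Proof.
have H g : carrier X g -> nrm X (- g) <= nrm X g.
  move=> Xg; rewrite -sub0r; apply: le_trans (ler_nrmB snX _ Xg) _.
    exact: carrier0.
  by rewrite nrm0// add0r.
move=> Xf; apply/eqP; rewrite eq_le H//= -[in leLHS](opprK f) H//.
exact: carrierN.
Qed.

Lemma ler_nrmD f g : carrier X f -> carrier X g ->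
  nrm X (f + g) <= nrm X f + nrm X g.
Proof.
move=> Xf Xg; rewrite -(nrmN Xg) -[in leLHS](opprK g).
by apply: ler_nrmB => //; exact: carrierN.
Qed.

End seminormed.

Section K_functional.
Context {R : realType} {V : lmodType R} (X0 X1 : normed_subset V).
Hypotheses (sn0 : is_seminormed X0) (sn1 : is_seminormed X1).
Implicit Types (f g : V) (t : R).

Local Notation K := (Kfun X0 X1).
Local Notation S := (sum_carrier X0 X1).

Lemma sum_carrierD f g : S f -> S g -> S (f + g).
Proof.
move=> [f0 [f1 [Xf0 Xf1 ->]]] [g0 [g1 [Xg0 Xg1 ->]]].
by exists (f0 + g0), (f1 + g1); split; [exact: carrierD..|rewrite addrACA].
Qed.

Lemma sum_carrierl f : carrier X0 f -> S f.
Proof. by move=> Xf; exists f, 0; split; [|exact: carrier0|rewrite addr0]. Qed.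

Lemma sum_carrierr f : carrier X1 f -> S f.
Proof. by move=> Xf; exists 0, f; split; [exact: carrier0| |rewrite add0r]. Qed.

Lemma Kfun_ge0 t f : 0 <= t -> (0 <= K t f)%E.
Proof.
move=> t0; apply: le_ereal_inf_tmp => _ [f0 [f1 [_ _ _ ->]]].
by rewrite lee_fin addr_ge0 ?mulr_ge0 ?nrm_ge0.
Qed.

Lemma Kfun_le t f0 f1 : carrier X0 f0 -> carrier X1 f1 ->
  (K t (f0 + f1) <= (nrm X0 f0 + t * nrm X1 f1)%:E)%E.
Proof. by move=> Xf0 Xf1; apply: ereal_inf_lbound; exists f0, f1. Qed.

Lemma Kfun_le0 t f : carrier X0 f -> (K t f <= (nrm X0 f)%:E)%E.
Proof.
move=> Xf; rewrite -[in leLHS](addr0 f); apply: le_trans (Kfun_le _ Xf _) _.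
  exact: carrier0.
by rewrite nrm0// mulr0 addr0.
Qed.

Lemma Kfun_le1 t f : carrier X1 f -> (K t f <= (t * nrm X1 f)%:E)%E.
Proof.
move=> Xf; rewrite -[in leLHS](add0r f); apply: le_trans (Kfun_le _ _ Xf) _.
  exact: carrier0.
by rewrite nrm0// add0r.
Qed.

Lemma Kfun_fin_num t f : 0 <= t -> S f -> K t f \is a fin_num.
Proof.
move=> t0 [f0 [f1 [Xf0 Xf1 ->]]].
rewrite ge0_fin_numE ?Kfun_ge0//.
by apply: le_lt_trans (Kfun_le _ _ _) (ltry _).
Qed.

Lemma Kfun_decomposition t f (c : R) : (K t f < c%:E)%E ->
  exists f0 f1, [/\ carrier X0 f0, carrier X1 f1, f = f0 + f1 &
    nrm X0 f0 + t * nrm X1 f1 < c].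
Proof.
move=> /ereal_inf_lt [_ [f0 [f1 [Xf0 Xf1 -> ->]]]] h.
by exists f0, f1.
Qed.

Lemma KfunD t f g : 0 <= t -> S f -> S g -> (K t (f + g) <= K t f + K t g)%E.
Proof.
move=> t0 Sf Sg; apply/lee_addgt0Pr => e e0.
have h (h' : V) : S h' -> exists2 c, (K t h' < c%:E)%E & (c%:E <=
  K t h' + (e / 2)%:E)%E.
  move=> /(Kfun_fin_num t0) /fineK Kh; exists (fine (K t h') + e / 2).
    by rewrite -Kh lte_fin ltrDl divr_gt0.
  by rewrite -[in leRHS]Kh.
have [c cf cle] := h f Sf.
have [d dg dle] := h g Sg.
have [f0 [f1 [Xf0 Xf1 fE hc]]] := Kfun_decomposition cf.
have [g0 [g1 [Xg0 Xg1 gE hd]]] := Kfun_decomposition dg.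
apply: (@le_trans _ _ (c%:E + d%:E)%E).
  rewrite fE gE addrACA; apply: le_trans (Kfun_le _ _ _) _; [exact: carrierD..|].
  rewrite lee_fin.
  have := ler_nrmD sn0 Xf0 Xg0.
  have := ler_wpM2l t0 (ler_nrmD sn1 Xf1 Xg1); lra.
apply: le_trans (leeD cle dle) _.
by rewrite addeACA -EFinD -splitr.
Qed.

Lemma le_Kfun f s t : s <= t -> (K s f <= K t f)%E.
Proof.
move=> st; apply: le_ereal_inf_tmp => _ [f0 [f1 [Xf0 Xf1 -> ->]]].
apply: le_trans (Kfun_le _ Xf0 Xf1) _.
by rewrite lee_fin lerD2l ler_wpM2r// nrm_ge0.
Qed.

(** A decomposition of f serves both scales, and c >= 1 times its cost at t dominates its cost at c
    t. Equivalently, K(t) / t is nonincreasing. *)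
Lemma Kfun_scale f (c : R) t : 1 <= c -> 0 <= t -> S f ->
  (K (c * t) f <= c%:E * K t f)%E.
Proof.
move=> c1 t0 Sf; have c0 : 0 < c by apply: lt_le_trans c1.
rewrite -lee_pdivrMl//; apply: le_ereal_inf_tmp => _ [f0 [f1 [Xf0 Xf1 -> ->]]].
rewrite lee_pdivrMl//; apply: le_trans (Kfun_le _ Xf0 Xf1) _.
rewrite -EFinM lee_fin mulrDr mulrA lerD2r ler_peMl// nrm_ge0//.
Qed.

End K_functional.

Section cvge0.
Context {R : realType} {T : Type} (F : set_system T) {FF : Filter F}.
Implicit Types u : T -> \bar R.
Local Open Scope ereal_scope.

Lemma cvge0_lt u e : (0 < e)%R -> u x @[x --> F] --> 0 ->
  \forall x \near F, u x < e%:E.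
Proof.
by move=> e0 h; exact: (h _ (@nbhs_open_ereal_lt _ 0%R (fun=> e) e0)).
Qed.

Lemma cvge0P u : (forall x, 0 <= u x) ->
  (forall e : R, (0 < e)%R -> \forall x \near F, u x <= e%:E) ->
  u x @[x --> F] --> 0.
Proof.
move=> u0 h.
have ufin : \forall x \near F, u x \is a fin_num.
  near=> x; rewrite ge0_fin_numE//; apply: (@le_lt_trans _ _ 1%:E);
    last exact: ltry.
  by near: x; exact: h.
apply/fine_cvgP; split => //; apply/cvgr0Pnorm_le => e e0; near=> x.
rewrite /= ger0_norm ?fine_ge0// -lee_fin fineK; last by near: x.
by near: x; exact: h.
Unshelve. all: by end_near. Qed.

End cvge0.

(** * The Gagliardo completion leaves K unchanged *)

Section gagliardo.
Context {R : realType} {V : lmodType R} (X0 X1 Y : normed_subset V).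
Hypotheses (sn0 : is_seminormed X0) (sn1 : is_seminormed X1) (snY :
  is_seminormed Y).
Hypothesis YS : carrier Y `<=` sum_carrier X0 X1.
Implicit Types (a f : V) (M c t : R).

Local Notation G := (gagliardo X0 X1 Y).
Local Notation K := (Kfun X0 X1).

Let sup_ge0 a s : approximations X0 X1 Y a s ->
  0 <= sup (range (fun n => nrm Y (s n))).
Proof.
move=> [_ [M sM] _]; apply: (le_trans (nrm_ge0 snY (s 0%N))).
by apply: ub_le_sup; [exists M => _ [n _ <-]|exists 0%N].
Qed.

Lemma gagliardo_ge0 a : 0 <= nrm G a.
Proof.
have [A0|/set0P A0] := eqVneq (approximations X0 X1 Y a) set0.
  by rewrite /= A0 image_set0 inf0.
by apply: lb_le_inf; [exact: image_nonempty|move=> _ [s /sup_ge0 ? <-]].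
Qed.

Lemma gagliardo_le a s M : approximations X0 X1 Y a s ->
  (forall n, nrm Y (s n) <= M) -> nrm G a <= M.
Proof.
move=> As sM; apply: (@le_trans _ _ (sup (range (fun n => nrm Y (s n))))).
  by apply: ge_inf; [exists 0 => _ [s' /sup_ge0 ? <-]|exists s].
by apply: ge_sup; [exists (nrm Y (s 0%N)), 0%N|move=> _ [n _ <-]].
Qed.

Lemma sub_gagliardo f : carrier Y f -> carrier G f /\ nrm G f <= nrm Y f.
Proof.
move=> Yf; have As : approximations X0 X1 Y f (fun=> f).
  split => //; first by exists (nrm Y f).
  apply: cvge0P => [_|e e0]; first exact: Kfun_ge0.
  apply: nearW => _; rewrite subrr; apply: le_trans (Kfun_le0 _ _ _) _ => //.
    exact: carrier0.
  by rewrite nrm0// lee_fin ltW.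
split; first by split; [exact: YS|exists (fun=> f)].
exact: gagliardo_le As _.
Qed.

Lemma gagliardo_lt a c : carrier G a -> nrm G a < c ->
  exists2 s, approximations X0 X1 Y a s & forall n, nrm Y (s n) < c.
Proof.
move=> [Sa A0] /inf_lt; case; first exact: image_nonempty.
move=> _ [s As <-] sc; exists s => // n; apply: le_lt_trans sc.
by case: As => _ [M sM] _; apply: ub_le_sup; [exists M => _ [m _ <-]|exists n].
Qed.

Lemma sum_carrierB f g : sum_carrier X0 X1 f -> sum_carrier X0 X1 g ->
  sum_carrier X0 X1 (f - g).
Proof.
move=> [f0 [f1 [Xf0 Xf1 ->]]] [g0 [g1 [Xg0 Xg1 ->]]].
by exists (f0 - g0), (f1 - g1); split; [exact: carrierB..|rewrite addrACA opprD].
Qed.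

Lemma KfunN t f : K t (- f) = K t f.
Proof.
have H g : (K t (- g) <= K t g)%E.
  apply: le_ereal_inf_tmp => _ [f0 [f1 [Xf0 Xf1 -> ->]]].
  rewrite opprD -(nrmN sn0 Xf0) -(nrmN sn1 Xf1).
  by apply: Kfun_le; exact: carrierN.
by apply/eqP; rewrite eq_le H -[in leLHS](opprK f) H.
Qed.

(** Turns convergence in A_0 + A_1, which is convergence of K(1), into convergence of K(t) at each
    fixed t. *)
Lemma Kfun_le_max1 t f : 0 <= t -> sum_carrier X0 X1 f ->
  (K t f <= (Num.max 1 t)%:E * sum_norm X0 X1 f)%E.
Proof.
move=> t0 Sf; apply: (@le_trans _ _ (K (Num.max 1 t) f)).
  by apply: le_Kfun => //; rewrite le_max lexx orbT.
by rewrite -{1}(mulr1 (Num.max 1 t)); apply: Kfun_scale => //;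
  rewrite le_max lexx.
Qed.

(** A bound on K(t, s_n) passes to the limit because K(t, a - s_n) tends to 0; this is why K does
    not see the completion. *)
Lemma Kfun_closed t a s M : 0 <= t -> sum_carrier X0 X1 a ->
  approximations X0 X1 Y a s ->
  (forall n, (K t (s n) <= M%:E)%E) -> (K t a <= M%:E)%E.
Proof.
move=> t0 Sa [Ys _ cs] sM; apply/lee_addgt0Pr => e e0.
have c0 : 0 < Num.max 1 t by rewrite lt_max ltr01.
have : 0 < e / Num.max 1 t by rewrite divr_gt0.
move=> /(cvge0_lt)/(_ cs) [n _ /(_ _ (leqnn n)) sn].
have -> : a = s n + (a - s n) by rewrite addrC subrK.
have Sn := YS (Ys n).
apply: le_trans (KfunD _ _ t0 _ _) _ => //; first exact: sum_carrierB.
apply: leeD => //; rewrite -opprB KfunN.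
apply: le_trans (Kfun_le_max1 t0 _) _; first exact: sum_carrierB.
by rewrite -lee_pdivlMl//= -EFinM mulrC ltW.
Qed.

End gagliardo.

Section gagliardo_couple.
Context {R : realType} {V : lmodType R} (X0 X1 : normed_subset V).
Hypotheses (sn0 : is_seminormed X0) (sn1 : is_seminormed X1).
Implicit Types (f : V) (t : R).

Local Notation G0 := (gagliardo X0 X1 X0).
Local Notation G1 := (gagliardo X0 X1 X1).

Let X0S : carrier X0 `<=` sum_carrier X0 X1.
Proof. by move=> f; exact: sum_carrierl. Qed.

Let X1S : carrier X1 `<=` sum_carrier X0 X1.
Proof. by move=> f; exact: sum_carrierr. Qed.

Lemma Kfun_gagliardo_le t f : 0 <= t ->
  (Kfun G0 G1 t f <= Kfun X0 X1 t f)%E.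
Proof.
move=> t0; apply: le_ereal_inf_tmp => _ [f0 [f1 [Xf0 Xf1 -> ->]]].
have [G0f0 le0] := sub_gagliardo sn0 sn1 sn0 X0S Xf0.
have [G1f1 le1] := sub_gagliardo sn0 sn1 sn1 X1S Xf1.
apply: (@le_trans _ _ (nrm G0 f0 + t * nrm G1 f1)%:E).
  by apply: ereal_inf_lbound; exists f0, f1.
by rewrite lee_fin lerD// ler_wpM2l.
Qed.

Lemma Kfun_le_gagliardo0 t f : 0 <= t -> carrier G0 f ->
  (Kfun X0 X1 t f <= (nrm G0 f)%:E)%E.
Proof.
move=> t0 Gf; apply/lee_addgt0Pr => e e0.
have [|s As sM] := gagliardo_lt Gf (c := nrm G0 f + e); first by rewrite ltrDl.
apply: (Kfun_closed sn0 sn1 X0S t0 Gf.1 As) => n.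
apply: le_trans (Kfun_le0 _ _ _) _ => //; first by case: As.
by rewrite lee_fin ltW.
Qed.

Lemma Kfun_le_gagliardo1 t f : 0 < t -> carrier G1 f ->
  (Kfun X0 X1 t f <= (t * nrm G1 f)%:E)%E.
Proof.
move=> t0 Gf; apply/lee_addgt0Pr => e e0.
have [|s As sM] := gagliardo_lt Gf (c := nrm G1 f + e / t).
  by rewrite ltrDl divr_gt0.
apply: (Kfun_closed sn0 sn1 X1S (ltW t0) Gf.1 As) => n.
apply: le_trans (Kfun_le1 _ _ _) _ => //; first by case: As.
have -> : t * nrm G1 f + e = t * (nrm G1 f + e / t).
  by rewrite mulrDr mulrCA mulfV ?mulr1// gt_eqF.
by rewrite lee_fin ler_pM2l// ltW.
Qed.

Lemma sum_carrier_gagliardo : sum_carrier G0 G1 = sum_carrier X0 X1.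
Proof.
apply/seteqP; split => f [f0 [f1 [Xf0 Xf1 ->]]].
  by apply: sum_carrierD => //; [exact: Xf0.1|exact: Xf1.1].
exists f0, f1; split => //.
  by have [] := sub_gagliardo sn0 sn1 sn0 X0S Xf0.
by have [] := sub_gagliardo sn0 sn1 sn1 X1S Xf1.
Qed.

(** The completed norms are smaller, whence one inequality. Conversely, a part in a completed space
    is a limit of a bounded sequence of the original one, so its K is at most its completed norm
    (times t for A_1), and subadditivity of K recombines the parts. *)
Lemma Kfun_gagliardo t f : 0 < t -> Kfun G0 G1 t f = Kfun X0 X1 t f.
Proof.
move=> t0; apply/le_anti/andP; split; first exact/Kfun_gagliardo_le/ltW.
apply: le_ereal_inf_tmp => _ [f0 [f1 [Gf0 Gf1 -> ->]]].
apply: le_trans (KfunD _ _ (ltW t0) Gf0.1 Gf1.1) _ => //.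
by rewrite EFinD leeD// ?Kfun_le_gagliardo0 ?Kfun_le_gagliardo1// ltW.
Qed.

End gagliardo_couple.

(** * Density of the intersection and the behaviour of K at 0 and at infinity *)

Section density.
Context {R : realType} {V : lmodType R} (X0 X1 : normed_subset V).
Hypotheses (sn0 : is_seminormed X0) (sn1 : is_seminormed X1).
Hypothesis dense0 : forall f (e : R), carrier X0 f -> 0 < e ->
  exists g, [/\ carrier X0 g, carrier X1 g & nrm X0 (f - g) < e].
Hypothesis dense1 : forall f (e : R), carrier X1 f -> 0 < e ->
  exists g, [/\ carrier X0 g, carrier X1 g & nrm X1 (f - g) < e].
Implicit Types (f : V) (t : R).

(** An element g of the intersection replaces [f0] up to e / 2 and joins the A_1-part, whose norm N
    is then fixed, so that t N becomes small with t. *)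
Lemma Kfun_small f (e : R) : sum_carrier X0 X1 f -> 0 < e ->
  exists2 t, 0 < t & (Kfun X0 X1 t f <= e%:E)%E.
Proof.
move=> [f0 [f1 [Xf0 Xf1 ->]]] e0.
have [|g [X0g X1g ge]] := dense0 Xf0 (e := e / 2); first by rewrite divr_gt0.
pose N := nrm X1 (g + f1).
have N0 : 0 <= N by exact: nrm_ge0.
exists (e / 2 / (N + 1)); first by rewrite !divr_gt0// ltr_wpDl.
have -> : f0 + f1 = (f0 - g) + (g + f1) by rewrite addrA subrK.
apply: le_trans (Kfun_le _ _ _) _; [exact: carrierB|exact: carrierD|].
rewrite lee_fin -/N.
have : N / (N + 1) <= 1 by rewrite ler_pdivrMr ?ltr_wpDl//; lra.
have -> : e / 2 / (N + 1) * N = e / 2 * (N / (N + 1)) by ring.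
move=> ?; have : e / 2 * (N / (N + 1)) <=
  e / 2 by rewrite ler_piMr// ltW// divr_gt0.
lra.
Qed.

(** Mirror image: g approximates [f1] and joins the A_0-part, whose fixed norm N is below t e / 2
    for the chosen t. *)
Lemma Kfun_small_infty f (e : R) : sum_carrier X0 X1 f -> 0 < e ->
  exists2 t, 0 < t & (Kfun X0 X1 t f <= (t * e)%:E)%E.
Proof.
move=> [f0 [f1 [Xf0 Xf1 ->]]] e0.
have [|g [X0g X1g ge]] := dense1 Xf1 (e := e / 2); first by rewrite divr_gt0.
pose N := nrm X0 (f0 + g).
have N0 : 0 <= N by exact: nrm_ge0.
have t0 : 0 < (N + 1) / (e / 2) by rewrite !divr_gt0// ltr_wpDl.
exists ((N + 1) / (e / 2)) => //; set t := _ / _ in t0 *.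
have tE : t * (e / 2) = N + 1 by rewrite /t divfK// gt_eqF// divr_gt0.
have -> : f0 + f1 = (f0 + g) + (f1 - g) by rewrite addrAC -addrA subrK addrC.
apply: le_trans (Kfun_le _ _ _) _; [exact: carrierD|exact: carrierB|].
rewrite lee_fin -/N.
have : t * nrm X1 (f1 - g) <= t * (e / 2) by rewrite ler_pM2l// ltW.
have -> : t * e = t * (e / 2) + t * (e / 2) by rewrite -mulrDr -splitr.
rewrite tE; lra.
Qed.

End density.

(** * Integrals of slowly varying weights *)

Section lebesgue_measurability.
Context {R : realType}.
Local Notation mu := (@completed_lebesgue_measure R).
Implicit Types (A : set R) (f : R -> \bar R).

Lemma measurable_lebesgueType A :
  measurable A -> measurable (A : set (lebesgueType R)).
Proof. exact: sub_caratheodory. Qed.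

Lemma measurable_itv_lebesgueType (i : interval R) :
  measurable ([set` i] : set (lebesgueType R)).
Proof. by apply: measurable_lebesgueType; exact: measurable_itv. Qed.

Lemma completed_lebesgue_measure_itvco (x y : R) : x <= y ->
  mu (`[x, y[%classic : set (lebesgueType R)) = (y - x)%:E.
Proof.
move=> xy; have -> : mu (`[x, y[%classic : set (lebesgueType R)) =
  lebesgue_measure (`[x, y[%classic : set R) by [].
rewrite lebesgue_measure_itv/= lte_fin; case: ltgtP xy => // -> _.
by rewrite subrr.
Qed.

(** Each superlevel set inside D is an interval, hence Borel, hence measurable for the completed
    measure. *)
Lemma emeasurable_nondecreasing (D : set R) f : is_interval D ->
  {in D &, {homo f : s t / s <= t >-> (s <= t)%E}} ->
  measurable_fun (D : set (lebesgueType R)) f.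
Proof.
move=> iD ndf mD; apply: (measurability (@ErealGenCInfty.G R)) => //.
  exact: ErealGenCInfty.measurableE.
move=> /= _ [_ [r] ->] <-; apply: measurable_lebesgueType.
apply: is_interval_measurable => s t/= [Ds fs] [Dt ft] u /andP[su ut].
have Du : D u by apply: (iD s t) => //; apply/andP.
split => //=; move: fs; rewrite /= !in_itv/= !andbT => /le_trans; apply.
by apply: ndf; rewrite ?inE.
Qed.

Lemma emeasurable_nonincreasing (D : set R) f : is_interval D ->
  {in D &, {homo f : s t / s <= t >-> (t <= s)%E}} ->
  measurable_fun (D : set (lebesgueType R)) f.
Proof.
move=> iD nif; rewrite (_ : f = \- (\- f))%E; last first.
  by apply/funext => x; rewrite oppeK.
apply: measurableT_comp; first exact: oppe_measurable.
apply: emeasurable_nondecreasing; first exact: iD.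
by move=> s t Ds Dt st; rewrite leeN2 nif.
Qed.

Lemma emeasurable_powR (p : R) :
  measurable_fun (`]0%R, +oo[ : set (lebesgueType R)) (fun t => (t `^ p)%:E).
Proof.
have iD : is_interval (`]0, +oo[ : set R) by exact: interval_is_interval.
have [p0|p0] := leP 0 p.
  apply: emeasurable_nondecreasing => // s t; rewrite !inE/= !in_itv/= !andbT.
  by move=> s0 t0 st; rewrite lee_fin ge0_ler_powR// nnegrE ltW.
apply: emeasurable_nonincreasing => // s t; rewrite !inE/= !in_itv/= !andbT.
move=> s0 t0 st; rewrite lee_fin -(opprK p) !(powRN _ (- p)) lef_pV2 ?posrE
  ?powR_gt0//.
by apply: ge0_ler_powR; rewrite ?nnegrE ?oppr_ge0//; exact: ltW.
Qed.

End lebesgue_measurability.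

(** * Dyadic blocks of a weight with power-type growth or decay *)

Section dyadic_integrals.
Context {R : realType}.
Local Notation mu := (@completed_lebesgue_measure R).
Context (w : R -> R) (C d : R).
Hypothesis C0 : 0 <= C.
Hypothesis w_ge0 : forall t, 0 < t -> 0 <= w t.
Hypothesis mw : measurable_fun (`]0%R, +oo[ : set (lebesgueType R))
  (fun t => (w t / t)%:E).
Hypothesis wle : forall s t, 0 < s -> s <= t -> w t <= C * (t / s) `^ d * w s.

Local Notation I A :=
  (\int[mu]_(u in (A%classic : set (lebesgueType R))) (w u / u)%:E)%E.

Let mwS (A : set (lebesgueType R)) : A `<=` `]0, +oo[ ->
  measurable_fun A (fun t => (w t / t)%:E).
Proof.
move=> A0; apply: measurable_funS mw => //.
exact: measurable_itv_lebesgueType.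
Qed.

Let co_pos (s t : R) : 0 < s -> `[s, t[ `<=` `]0, +oo[.
Proof.
by move=> s0 u; rewrite /= !in_itv/= andbT => /andP[/(lt_le_trans s0)].
Qed.

Let wdiv_ge0 (u : R) : `]0, +oo[%classic u -> (0 <= (w u / u)%:E)%E.
Proof.
by rewrite /= in_itv/= andbT => u0; rewrite lee_fin divr_ge0 ?w_ge0// ltW.
Qed.

Let powR_bound (x : R) : 1 <= x -> x <= 2 -> x `^ d <= 2 `^ `|d|.
Proof.
move=> x1 x2; apply: (@le_trans _ _ (x `^ `|d|)).
  by rewrite ler_powR// ler_norm.
by rewrite ge0_ler_powR ?nnegrE// (le_trans _ x1).
Qed.

(** On [2^n s, 2^(n+1) s) the integrand is at most C 2^|d| (2^d)^n w(s) / (2^n s), and this block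
    has length 2^n s. The sign of d is free: positive for the growth of the primitive, negative for
    the tail integral. *)
Lemma integral_dyadic_le (s : R) n : 0 < s ->
  (I (`[s, (2 ^+ n * s)%R[) <=
    (C * 2 `^ `|d| * w s * \sum_(i < n) (2 `^ d) ^+ i)%:E)%E.
Proof.
move=> s0; elim: n => [|n IH].
  by rewrite expr0 mul1r set_itvco0 integral_set0 big_ord0 mulr0.
set a := 2 ^+ n * s in IH *.
have a0 : 0 < a by rewrite mulr_gt0// exprn_gt0.
have sa : s <= a by apply: ler_peMl; [exact: ltW|rewrite exprn_ege1// ler1n].
have a2a : a <= 2 * a by lra.
have aE : 2 ^+ n.+1 * s = 2 * a by rewrite exprS mulrA.
have -> : `[s, 2 ^+ n.+1 * s[%classic = `[s, a[ `|` `[a, 2 * a[ :> set R.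
  by rewrite -itv_bndbnd_setU ?bnd_simp// aE.
rewrite ge0_integral_setU; first last.
- rewrite disj_set2E; apply/eqP; rewrite -subset0 => u/= [].
  by rewrite !in_itv/= => /andP[_ ua] /andP[au]; rewrite ltNge au in ua.
- by move=> u [/(co_pos s0)|/(co_pos a0)]; exact: wdiv_ge0.
- by apply: mwS => u [/(co_pos s0)|/(co_pos a0)].
- exact: measurable_itv_lebesgueType.
- exact: measurable_itv_lebesgueType.
rewrite big_ord_recr/= mulrDr EFinD; apply: leeD => //.
set c := C * 2 `^ `|d| * w s * (2 `^ d) ^+ n.
pose D : set (lebesgueType R) := `[a, 2 * a[%classic.
apply: (@le_trans _ _ (\int[mu]_(u in D) cst (c / a)%:E u)%E).
  apply: ge0_le_integral.
  - exact: measurable_itv_lebesgueType.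
  - by move=> u /(co_pos a0); exact: wdiv_ge0.
  - by apply: mwS; exact: co_pos.
  - exact: measurable_cst.
  move=> u; rewrite /= in_itv/= => /andP[au ua]; rewrite lee_fin.
  have u0 : 0 < u by exact: lt_le_trans au.
  apply: ler_pM; [exact: w_ge0|by rewrite invr_ge0 ltW| |by rewrite lef_pV2].
  apply: le_trans (wle s0 (le_trans sa au)) _.
  have -> : c = C * (2 `^ `|d| * (2 `^ d) ^+ n) * w s by rewrite /c; ring.
  apply: ler_wpM2r; first exact: w_ge0.
  apply: ler_wpM2l => //.
  have -> : u / s = u / a * 2 ^+ n 
    by rewrite /a; field; rewrite (gt_eqF s0) gt_eqF// exprn_gt0.
  rewrite powRM ?divr_ge0 ?exprn_ge0 ?(ltW u0) ?(ltW a0)//.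
  have -> : (2 ^+ n) `^ d = (2 `^ d) ^+ n.
    by rewrite -powR_mulrn// powRAC powR_mulrn ?powR_ge0.
  rewrite ler_wpM2r ?powR_ge0// powR_bound//.
    by rewrite ler_pdivlMr// mul1r.
  by rewrite ler_pdivrMr// ltW.
rewrite integral_cst; last exact: measurable_itv_lebesgueType.
rewrite [X in (_ * X)%E](completed_lebesgue_measure_itvco a2a).
by rewrite -EFinM lee_fin (_ : 2 * a - a = a) ?divfK ?gt_eqF//; lra.
Qed.

(** For u in [s/2, s) both w(s) <= C 2^|d| w(u) and 1 / s <= 1 / u, so the value at s is bounded by
    an average over the block before it. *)
Lemma le_integral_dyadic (s : R) : 0 < s ->
  ((w s)%:E <= (2 * C * 2 `^ `|d|)%:E * I (`[(s / 2)%R, s[))%E.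
Proof.
move=> s0; have a0 : 0 < s / 2 by rewrite divr_gt0.
pose D : set (lebesgueType R) := `[s / 2, s[%classic.
have as_ : s / 2 <= s by lra.
apply: (@le_trans _ _ (\int[mu]_(u in D) ((2 * C * 2 `^ `|d|)%:E * (w u /
  u)%:E))%E); last first.
  rewrite ge0_integralZl_EFin.
  - exact: le_refl.
  - exact: measurable_itv_lebesgueType.
  - by move=> u /(co_pos a0); exact: wdiv_ge0.
  - by apply: mwS; exact: co_pos.
  - by rewrite !mulr_ge0// powR_ge0.
(* The block has length s / 2, hence the density 2 w(s) / s and the factor 2 in the constant. *)
have -> : ((w s)%:E = \int[mu]_(u in D) cst (2 * w s / s)%:E u)%E.
  rewrite integral_cst; last exact: measurable_itv_lebesgueType.
  rewrite [X in (_ * X)%E](completed_lebesgue_measure_itvco as_) -EFinM;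
    congr EFin.
  by field; rewrite gt_eqF.
apply: ge0_le_integral.
- exact: measurable_itv_lebesgueType.
- move=> u; rewrite /D/= in_itv/= => /andP[au us].
  by rewrite lee_fin divr_ge0 ?mulr_ge0 ?w_ge0// ltW.
- exact: measurable_cst.
- by apply: measurable_funeM; apply: mwS; exact: co_pos.
move=> u; rewrite /D/= in_itv/= => /andP[au us]; rewrite -EFinM lee_fin.
have u0 : 0 < u by exact: lt_le_trans au.
rewrite mulrA; apply: ler_pM.
- by rewrite mulr_ge0// w_ge0.
- by rewrite invr_ge0 ltW.
- rewrite -!mulrA ler_pM2l// mulrA.
  apply: le_trans (wle u0 (ltW us)) _.
  apply: ler_wpM2r; first exact: w_ge0.
  apply: ler_wpM2l => //; apply: powR_bound.
    by rewrite ler_pdivlMr// mul1r ltW.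
  by rewrite ler_pdivrMr//; lra.
- by rewrite lef_pV2// ltW.
Qed.

End dyadic_integrals.

Section geometric_sums.
Context {R : realType}.

Lemma exists_exprn_gt (x : R) : exists n, x < 2 ^+ n.
Proof.
have [n xn] : exists n : nat, x < n%:R.
  exists (Num.bound `|x|); apply: le_lt_trans (archi_boundP (normr_ge0 x)).
  exact: ler_norm.
by exists n; apply: lt_trans xn _; rewrite -natrX ltr_nat ltn_expl.
Qed.

Lemma geometric_sum_lt1 (r : R) n : 0 <= r -> r < 1 ->
  \sum_(i < n) r ^+ i <= (1 - r)^-1.
Proof.
move=> r0 r1; have r1' : 0 < 1 - r by rewrite subr_gt0.
rewrite -[leRHS]mul1r ler_pdivlMr// mulrC -opprB mulNr -subrX1 opprB.
by rewrite gerBl exprn_ge0.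
Qed.

Lemma geometric_sum_gt1 (r : R) n : 1 < r ->
  \sum_(i < n) r ^+ i <= (r - 1)^-1 * r ^+ n.
Proof.
move=> r1; have r1' : 0 < r - 1 by rewrite subr_gt0.
by rewrite mulrC ler_pdivlMr// mulrC -subrX1 gerBl.
Qed.

Lemma powRX (x d : R) n : 0 <= x -> (x ^+ n) `^ d = (x `^ d) ^+ n.
Proof. by move=> x0; rewrite -powR_mulrn// powRAC powR_mulrn ?powR_ge0. Qed.

Lemma powRV (x d : R) : 0 <= x -> x^-1 `^ d = x `^ (- d).
Proof. by move=> x0; rewrite -powR_inv1// -powRrM mulN1r. Qed.

Lemma powR_gt1 (x d : R) : 1 < x -> 0 < d -> 1 < x `^ d.
Proof.
move=> x1 d0; have -> : 1 = 1 `^ d :> R by rewrite powR1.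
by apply: gt0_ltr_powR; rewrite ?nnegrE// ltW// (lt_trans ltr01).
Qed.

End geometric_sums.

(** * Two-point inequalities for slowly varying functions *)

Section slowly_varying_theory.
Context {R : realType} (b : R -> \bar R) (b_sv : slowly_varying b).
Implicit Types (s t e : R).
Local Open Scope ereal_scope.

(** Eliminates the auxiliary monotone functions: passing through one of them uses the equivalence
    once at s and once at t, hence the squared constants. *)
Lemma slowly_varying_lee e : (0 < e)%R -> exists2 c : R, (0 < c)%R &
  forall s t, (0 < s)%R -> (s <= t)%R ->
    (s `^ e)%:E * b s <= c%:E * ((t `^ e)%:E * b t) /\
    (t `^ (- e))%:E * b t <= c%:E * ((s `^ (- e))%:E * b s).
Proof.
move=> e0; have [g ndg [c c0 cg]] := sv_increasing b_sv e0.
have [h nih [d d0 dh]] := sv_decreasing b_sv e0.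
exists (Num.max (c * c) (d * d))%R; first by rewrite lt_max mulr_gt0.
move=> s t s0 st; have t0 := lt_le_trans s0 st.
have in0 (x : R) : (0 < x)%R -> x \in (`]0%R, +oo[ : interval R).
  by move=> x0; rewrite in_itv/= andbT.
have bge0 p x : (0 < x)%R -> 0 <= (x `^ p)%:E * b x.
  by move=> x0; rewrite mule_ge0// ?lee_fin ?powR_ge0// ltW// (sv_gt0 b_sv).
split.
  apply: (@le_trans _ _ ((c * c)%:E * ((t `^ e)%:E * b t))); last first.
    by rewrite lee_wpmul2r ?bge0// lee_fin le_max lexx.
  apply: le_trans (cg s s0).1 _; rewrite EFinM -muleA lee_pmul2l ?lte_fin//.
  by apply: le_trans (cg t t0).2; apply: ndg => //; exact: in0.
apply: (@le_trans _ _ ((d * d)%:E * ((s `^ (- e))%:E * b s))); last first.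
  by rewrite lee_wpmul2r ?bge0// lee_fin le_max lexx orbT.
apply: le_trans (dh t t0).1 _; rewrite EFinM -muleA lee_pmul2l ?lte_fin//.
by apply: le_trans (dh s s0).2; apply: nih => //; exact: in0.
Qed.

(** A single finite value spreads to all of (0, +oo): the increasing comparison reaches the points
    to its left, the decreasing one those to its right. *)
Lemma slowly_varying_fin_num t : (0 < t)%R -> b t \is a fin_num.
Proof.
move=> t0; rewrite ge0_fin_numE; last exact/ltW/(sv_gt0 b_sv).
have [u u0 uy] := sv_neqy b_sv.
have bu : b u < +oo by rewrite ltey.
have [c c0 h] := slowly_varying_lee (@ltr01 R).
have mulfin p x y : (0 < x)%R -> (0 < y)%R ->
    (x `^ p)%:E * b x <= c%:E * ((y `^ p)%:E * b y) -> b y < +oo -> b x < +oo.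
  move=> x0 y0 /[swap] by_; case: (b x) => [r _||//]; first by rewrite ltry.
  rewrite gt0_muley ?lte_fin ?powR_gt0// leye_eq => /eqP h'.
  have : c%:E * ((y `^ p)%:E * b y) < +oo.
    by rewrite !lte_mul_pinfty ?lee_fin ?powR_ge0 ?ltW.
  by rewrite h'.
have [tu|ut] := leP t u.
  exact: (mulfin _ _ _ t0 u0 (h t u t0 tu).1).
exact: (mulfin _ _ _ t0 u0 (h u t u0 (ltW ut)).2).
Qed.

Local Close Scope ereal_scope.

(** This is b^q alone: the factor 1 / t that the overview includes in w is written out wherever
    [w u / u] appears. *)
Definition sv_pow (q t : R) : R := fine (b t) `^ q.

Lemma sv_pow_gt0 q t : 0 < t -> 0 < sv_pow q t.
Proof.
move=> t0; apply: powR_gt0; apply: fine_gt0.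
by rewrite (sv_gt0 b_sv)// ltey_eq slowly_varying_fin_num.
Qed.

(** The q-th power of the two-point inequality for the exponent d / q, so every d > 0 is available,
    with a constant depending on it. *)
Lemma sv_pow_le q d : 0 < q -> 0 < d -> exists2 c : R, 0 < c &
  forall s t, 0 < s -> s <= t -> sv_pow q t <= c * (t / s) `^ d * sv_pow q s.
Proof.
move=> q0 d0; have [|c c0 h] := @slowly_varying_lee (d / q).
  by rewrite divr_gt0.
exists (c `^ q); first exact: powR_gt0.
move=> s t s0 st; have t0 := lt_le_trans s0 st.
have := (h s t s0 st).2.
have /fineK bs := slowly_varying_fin_num s0.
have /fineK bt := slowly_varying_fin_num t0.
rewrite -[in X in (X -> _)]bs -[in X in (X -> _)]bt -!EFinM lee_fin => H.
have bge x : 0 < x -> 0 <= fine (b x).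
  by move=> x0; rewrite fine_ge0// ltW// (sv_gt0 b_sv).
have -> : c `^ q * (t / s) `^ d * sv_pow q s =
    (c * (t / s) `^ (d / q) * fine (b s)) `^ q.
  rewrite !(powRM q) ?mulr_ge0 ?powR_ge0 ?bge ?(ltW c0)//.
  by rewrite -powRrM divfK// gt_eqF.
apply: ge0_ler_powR; rewrite ?nnegrE ?mulr_ge0 ?powR_ge0 ?bge ?(ltW c0) ?(ltW
  q0)//.
have tp : 0 < t `^ (d / q) by exact: powR_gt0.
move: H; rewrite !powRN mulrC ler_pdivrMr// => /le_trans; apply.
rewrite powRM ?invr_ge0 ?(ltW t0) ?(ltW s0)// powRV ?(ltW s0)// powRN.
rewrite le_eqVlt; apply/orP; left; apply/eqP; ring.
Qed.

Lemma measurable_sv_pow q p : measurable_fun (`]0%R, +oo[ : set (lebesgueType R))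
  (fun t => (t `^ p * sv_pow q t)%:E).
Proof.
have : measurable_fun (`]0%R, +oo[ : set (lebesgueType R))
    (fun t => (t `^ p)%:E * b t `^ q)%E.
  apply: emeasurable_funM; first exact: emeasurable_powR.
  exact: (measurableT_comp (measurable_poweR q) (sv_measurable b_sv)).
apply: eq_measurable_fun => t; rewrite inE/= in_itv/= andbT => t0.
by rewrite EFinM /sv_pow -(poweR_EFin (fine (b t))) fineK//
  slowly_varying_fin_num.
Qed.

End slowly_varying_theory.

(** * The primitive W of b(u)^q du / u, which is B^q *)

Section weighted_primitive.
Context {R : realType} (b : R -> \bar R) (b_sv : slowly_varying b).
Context (q : R) (q0 : 0 < q).
Local Notation mu := (@completed_lebesgue_measure R).
Local Notation w := (sv_pow b q).
Implicit Types (s t d p : R).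

Definition sv_integral (A : set (lebesgueType R)) : \bar R :=
  (\int[mu]_(u in A) (w u / u)%:E)%E.

Local Notation W t := (sv_integral `]0, t[%classic).

Lemma measurable_sv_weight p : measurable_fun (`]0%R, +oo[ : set (lebesgueType R))
  (fun t => (t `^ p * w t / t)%:E).
Proof.
have := measurable_sv_pow b_sv q (p - 1).
apply: eq_measurable_fun => t; rewrite inE/= in_itv/= andbT => t0.
rewrite powRB ?(gt_eqF t0) ?implybT// powRr1 ?(ltW t0)//.
by congr EFin; rewrite mulrAC.
Qed.

Lemma measurable_sv_density : measurable_fun (`]0%R, +oo[ : set (lebesgueType R))
  (fun t => (w t / t)%:E).
Proof.
have := measurable_sv_weight 0.
by apply: eq_measurable_fun => t _; rewrite powRr0 mul1r.
Qed.

Lemma sv_density_ge0 t : `]0, +oo[%classic t -> (0 <= (w t / t)%:E)%E.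
Proof.
rewrite /= in_itv/= andbT => t0.
by rewrite lee_fin divr_ge0// ltW// sv_pow_gt0.
Qed.

Lemma subset_itvo0y (i : interval R) : (BRight 0 <= i.1)%O ->
  [set` i] `<=` `]0, +oo[.
Proof.
case: i => l r l0 u; rewrite /= itv_boundlr in_itv/= andbT => /andP[lu _].
by have := le_trans l0 lu; rewrite bnd_simp.
Qed.

Lemma measurable_sv_density_sub (i : interval R) : (BRight 0 <= i.1)%O ->
  measurable_fun ([set` i] : set (lebesgueType R)) (fun t => (w t / t)%:E).
Proof.
move=> i0; apply: measurable_funS measurable_sv_density.
  exact: measurable_itv_lebesgueType.
exact: subset_itvo0y.
Qed.

Lemma le_sv_integral (i j : interval R) : (BRight 0 <= j.1)%O ->
  [set` i] `<=` [set` j] -> (sv_integral [set` i] <= sv_integral [set` j])%E.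
Proof.
move=> j0 ij; apply: ge0_subset_integral; [| | | |exact: ij].
- exact: measurable_itv_lebesgueType.
- exact: measurable_itv_lebesgueType.
- exact: measurable_sv_density_sub.
- by move=> u /(subset_itvo0y j0); exact: sv_density_ge0.
Qed.

Lemma sv_integral_ge0 (i : interval R) : (BRight 0 <= i.1)%O ->
  (0 <= sv_integral [set` i])%E.
Proof.
by move=> i0; apply: integral_ge0 => u /(subset_itvo0y i0); exact: sv_density_ge0.
Qed.

Let W_ge0 t : (0 <= W t)%E.
Proof. exact: (@sv_integral_ge0 `]0, t[). Qed.

(** The integral over [s/2, s) alone dominates b(s)^q. After taking q-th roots this is b <= c B. *)
Lemma sv_pow_le_primitive : exists2 c : R, 0 < c &
  forall s, 0 < s -> ((w s)%:E <= c%:E * W s)%E.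
Proof.
have [c c0 wle] := sv_pow_le b_sv q0 (@ltr01 R).
exists (2 * c * 2 `^ `|1|); first by rewrite !mulr_gt0// powR_gt0.
move=> s s0; apply: le_trans (le_integral_dyadic (ltW c0) _ _ wle s0) _.
- by move=> t t0; exact/ltW/sv_pow_gt0.
- exact: measurable_sv_density.
- apply: lee_wpmul2l; first by rewrite lee_fin !mulr_ge0 ?powR_ge0// ltW.
  apply: (@le_sv_integral `[s / 2, s[ `]0, s[) => //.
  by apply: subset_itv; rewrite bnd_simp// divr_gt0.
Qed.

(** W(2^n s) is W(s) plus the integral over [s, 2^n s); the latter is a geometric sum of order
    (2^d)^n w(s), and w(s) <= c' W(s). *)
Lemma sv_primitive_dyadic d : 0 < d -> exists2 c : R, 0 < c &
  forall s n, 0 < s -> (W (2 ^+ n * s)%R <= (c * (2 `^ d) ^+ n)%:E * W s)%E.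
Proof.
move=> d0; have [c c0 wle] := sv_pow_le b_sv q0 d0.
have [c' c'0 wW] := sv_pow_le_primitive.
set r := 2 `^ d; have r1 : 1 < r.
  by apply: powR_gt1 => //; rewrite ltr1n.
have r1' : 0 < r - 1 by rewrite subr_gt0.
have r0 : 0 <= r by exact: powR_ge0.
set k := c * 2 `^ `|d| * (r - 1)^-1.
have k0 : 0 < k by rewrite !mulr_gt0 ?powR_gt0 ?invr_gt0.
exists (1 + k * c'); first by rewrite ltr_wpDr// ltW// mulr_gt0.
move=> s n s0.
have sn : s <= 2 ^+ n * s by apply: ler_peMl;
  [exact: ltW|rewrite exprn_ege1// ler1n].
have UE : `]0, s[ `|` `[s, 2 ^+ n * s[ = `]0, 2 ^+ n * s[%classic :> set R.
  by rewrite -itv_bndbnd_setU// bnd_simp.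
have -> : W (2 ^+ n * s) = (W s + sv_integral `[s, (2 ^+ n * s)%R[%classic)%E.
  rewrite /sv_integral -ge0_integral_setU.
  - by rewrite UE.
  - exact: measurable_itv_lebesgueType.
  - exact: measurable_itv_lebesgueType.
  - by rewrite UE; apply: measurable_sv_density_sub; exact: lexx.
  - by rewrite UE => u /(@subset_itvo0y `]0, 2 ^+ n * s[ (lexx _));
    exact: sv_density_ge0.
  - rewrite disj_set2E; apply/eqP; rewrite -subset0 => u/= [].
    by rewrite !in_itv/= => /andP[_ us] /andP[su]; rewrite ltNge su in us.
rewrite mulrDl mul1r EFinD ge0_muleDl; last 2 first.
- by rewrite lee_fin exprn_ge0.
- by rewrite lee_fin; apply: mulr_ge0; [exact/ltW/mulr_gt0|exact: exprn_ge0].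
apply: leeD.
  by apply: lee_pemull; [exact: W_ge0|rewrite lee_fin exprn_ege1// ltW].
apply: le_trans (integral_dyadic_le (ltW c0) _ _ wle n s0) _.
- by move=> t t0; exact/ltW/sv_pow_gt0.
- exact: measurable_sv_density.
- apply: (@le_trans _ _ ((k * r ^+ n)%:E * (w s)%:E)%E).
    have ws0 : 0 <= w s by exact/ltW/sv_pow_gt0.
    rewrite -EFinM lee_fin; set x := c * _.
    have -> : k * r ^+ n * w s = x * w s * ((r - 1)^-1 * r ^+ n).
      by rewrite /k -/x; ring.
    apply: ler_wpM2l; last exact: geometric_sum_gt1.
    by rewrite !mulr_ge0 ?powR_ge0// ltW.
  have -> : k * c' * r ^+ n = k * r ^+ n * c' by rewrite mulrAC.
  rewrite [in leRHS]EFinM -muleA; apply: lee_wpmul2l; last exact: wW.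
  by rewrite lee_fin; apply: mulr_ge0; [exact: ltW|exact: exprn_ge0].
Qed.

Lemma exprn_between (x : R) : 1 <= x -> exists n, x <= 2 ^+ n <= 2 * x.
Proof.
move=> x1; have [m xm] := exists_exprn_gt x.
have ex : exists n, x <= 2 ^+ n by exists m; exact: ltW.
case: (ex_minnP ex) => -[|n] xn nmin.
  by exists 0%N; rewrite xn expr0/=; lra.
exists n.+1; rewrite xn/=; have : 2 ^+ n < x by rewrite ltNge;
  apply/negP => /nmin; rewrite ltnn.
by rewrite exprS => h; rewrite ler_pM2l// ltW.
Qed.

(** t is rounded up to 2^n s with 2^n <= 2 t / s, at the cost of a factor 2^d. The value +oo is
    still allowed here; this inequality will propagate finiteness from W(1) to all t. *)
Lemma sv_primitive_growth d : 0 < d -> exists2 c : R, 0 < c &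
  forall s t, 0 < s -> s <= t -> (W t <= (c * (t / s) `^ d)%:E * W s)%E.
Proof.
move=> d0; have [c c0 h] := sv_primitive_dyadic d0.
exists (c * 2 `^ d); first by rewrite mulr_gt0// powR_gt0.
move=> s t s0 st; have t0 := lt_le_trans s0 st.
have [|n /andP[tn nt]] := @exprn_between (t / s);
  first by rewrite ler_pdivlMr// mul1r.
have tns : t <= 2 ^+ n * s by rewrite -ler_pdivrMr.
apply: (@le_trans _ _ (W (2 ^+ n * s))).
  by apply: (@le_sv_integral `]0, t[ `]0, 2 ^+ n * s[) => //;
    apply: subset_itvl; rewrite bnd_simp.
apply: le_trans (h s n s0) _; apply: lee_wpmul2r => //.
rewrite lee_fin -mulrA ler_pM2l// -powRX//.
have ts0 : 0 <= t / s by exact/ltW/divr_gt0.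
rewrite -powRM//; apply: ge0_ler_powR => //; first exact: ltW.
  by rewrite nnegrE exprn_ge0.
by rewrite nnegrE mulr_ge0.
Qed.

Hypothesis W1 : (W 1%R < +oo)%E.

Lemma sv_primitive_fin_num t : W t \is a fin_num.
Proof.
rewrite ge0_fin_numE//; have [t1|/ltW t1] := leP t 1.
  apply: le_lt_trans W1.
  by apply: (@le_sv_integral `]0, t[ `]0, 1[) => //; apply: subset_itvl;
    rewrite bnd_simp.
have [c c0 h] := sv_primitive_growth (@ltr01 R).
apply: le_lt_trans (h _ _ ltr01 t1) _.
by rewrite lte_mul_pinfty// lee_fin mulr_ge0 ?powR_ge0// ltW.
Qed.

Lemma sv_primitive_gt0 t : 0 < t -> (0 < W t)%E.
Proof.
move=> t0; have [c c0 h] := sv_pow_le_primitive.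
rewrite lt_neqAle W_ge0 andbT; apply/eqP => W0.
have := h t t0; rewrite -W0 mule0 lee_fin; apply/negP.
by rewrite -ltNge sv_pow_gt0.
Qed.

Lemma sv_integral_tail : exists2 c : R, 0 < c & forall s, 0 < s ->
  (\int[mu]_(u in (`[s, +oo[%classic : set (lebesgueType R)))
     (u `^ (- q) * w u / u)%:E <= (c * s `^ (- q))%:E * W s)%E.
Proof.
(* Half of the decay u^(-q) pays for the possible growth of w; the other half leaves the ratio
   2^(-q/2) < 1 of a convergent geometric sum. *)
have q2 : 0 < q / 2 by rewrite divr_gt0.
have [c c0 wle] := sv_pow_le b_sv q0 q2.
have [c' c'0 wW] := sv_pow_le_primitive.
set r : R := 2 `^ (- (q / 2)); have r1 : r < 1.
  by rewrite /r powRN invf_lt1 ?powR_gt0// powR_gt1// ltr1n.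
have r0 : 0 <= r by exact: powR_ge0.
pose v u := u `^ (- q) * w u.
have v_ge0 t : 0 < t -> 0 <= v t.
  by move=> t0; rewrite mulr_ge0 ?powR_ge0// ltW// sv_pow_gt0.
have vle s t : 0 < s -> s <= t -> v t <= c * (t / s) `^ (- (q / 2)) * v s.
  move=> s0 st; have t0 := lt_le_trans s0 st.
  have ts0 : 0 < t / s by rewrite divr_gt0.
  have -> : c * (t / s) `^ (- (q / 2)) * v s =
      t `^ (- q) * (c * (t / s) `^ (q / 2) * w s).
    have -> : t `^ (- q) = (t / s) `^ (- q) * s `^ (- q).
      by rewrite -powRM ?divfK ?gt_eqF// ltW.
    have -> : (t / s) `^ (- (q / 2)) = (t / s) `^ (- q) * (t / s) `^ (q / 2).
      rewrite -powRD; last by rewrite (gt_eqF ts0) implybT.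
      by congr powR; field.
    by rewrite /v; ring.
  by rewrite ler_wpM2l ?powR_ge0// wle.
have mv : measurable_fun (`]0%R, +oo[ : set (lebesgueType R)) (fun t => (v t /
  t)%:E).
  exact: measurable_sv_weight.
pose k := c * 2 `^ `|- (q / 2)| * (1 - r)^-1.
have k0 : 0 < k by rewrite !mulr_gt0 ?powR_gt0 ?invr_gt0 ?subr_gt0.
exists (k * c'); first exact: mulr_gt0.
move=> s s0.
(* Dyadic intervals exhaust the half-line and their integrals are bounded uniformly in n, so
   monotone convergence gives the tail. *)
pose F n : set (lebesgueType R) := `[s, 2 ^+ n * s[%classic.
have FE : `[s, +oo[%classic = \bigcup_n F n.
  apply/seteqP; split => u; rewrite /= in_itv/= ?andbT.
    move=> su; have [n un] := exists_exprn_gt (u / s).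
    by exists n => //; rewrite /F/= in_itv/= su -ltr_pdivrMr.
  by move=> [n _]; rewrite /F/= in_itv/= => /andP[].
have F0 n : F n `<=` `]0, +oo[.
  by apply: (@subset_itvo0y `[s, 2 ^+ n * s[); rewrite bnd_simp.
have cv : ((\int[mu]_(u in F n) (v u / u)%:E)%E @[n --> \oo] -->
    (\int[mu]_(u in \bigcup_n F n) (v u / u)%:E)%E).
  apply: ge0_nondecreasing_set_cvg_integral.
  - move=> m n mn; apply/subsetPset; apply: subset_itvl; rewrite bnd_simp.
    by rewrite ler_pM2r// ler_eXn2l// ltr1n.
  - by move=> n; exact: measurable_itv_lebesgueType.
  - move=> n; apply: measurable_funS mv => //.
    exact: measurable_itv_lebesgueType.
  - move=> n u /F0; rewrite /= in_itv/= andbT => u0.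
    by rewrite lee_fin divr_ge0 ?v_ge0// ltW.
rewrite FE; apply: (cvge_to_le cv); apply: nearW => n.
apply: le_trans (integral_dyadic_le (ltW c0) v_ge0 mv vle n s0) _.
apply: (@le_trans _ _ ((k * s `^ (- q))%:E * (w s)%:E)%E).
  rewrite -EFinM lee_fin -[2 `^ (- _)]/r.
  have -> : k * s `^ (- q) * w s = c * 2 `^ `|- (q / 2)| * v s * (1 - r)^-1.
    by rewrite /k /v; ring.
  apply: ler_wpM2l; last exact: geometric_sum_lt1.
  by rewrite !mulr_ge0 ?powR_ge0 ?v_ge0// ltW.
have -> : k * c' * s `^ (- q) = k * s `^ (- q) * c' by rewrite mulrAC.
rewrite [in leRHS]EFinM -muleA; apply: lee_wpmul2l; last exact: wW.
by rewrite lee_fin; apply: mulr_ge0; [exact: ltW|exact: powR_ge0].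
Qed.

End weighted_primitive.

Section Lq_norms.
Context {R : realType}.
Local Notation mu := (@completed_lebesgue_measure R).
Implicit Types (q t : R) (g : R -> \bar R).
Local Open Scope ereal_scope.

Lemma Lq_normE q (D : set (lebesgueType R)) g : q != 0%R ->
  Lq_norm q D g = (\int[mu]_(t in D) (`|g t| `^ q)) `^ q^-1.
Proof.
move=> q0; rewrite /Lq_norm unlock [in RHS]integral_mkcond.
congr (_ `^ _); apply: eq_integral => t _; rewrite /patch.
(* Off D the patched function takes the default extended real, which is 0, and 0^q = 0. *)
by case: ifPn => // _; rewrite -[point]/0 abse0 poweR0r.
Qed.

Lemma poweRK q (x : \bar R) : q != 0%R -> 0 <= x -> (x `^ q^-1) `^ q = x.
Proof. by move=> q0 x0; rewrite -poweRrM mulVf// poweRe1. Qed.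

Lemma le_poweR q (x y : \bar R) : (0 <= q)%R -> 0 <= x -> x <= y ->
  x `^ q <= y `^ q.
Proof.
move=> q0 x0 xy; apply: gt0_ler_poweR => //; rewrite in_itv/= leey andbT//.
exact: le_trans xy.
Qed.

End Lq_norms.

(** * Slow variation of B *)

Section Lq_primitive_slowly_varying.
Context {R : realType} (b : R -> \bar R) (b_sv : slowly_varying b).
Context (q : R) (q0 : 0 < q).
Hypothesis b_fin : (Lq_norm q `]0%R, 1%R[ (fun t => (t `^ (- q^-1))%:E * b t)
              < +oo)%E.
Local Notation mu := (@completed_lebesgue_measure R).
Local Notation w := (sv_pow b q).
Local Notation W t := (sv_integral b q `]0, t[%classic).
Local Notation B := (Lq_primitive q b).
Implicit Types (s t e : R).

Let qN0 : q != 0. Proof. by rewrite gt_eqF. Qed.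

Lemma Lq_primitiveE t : B t = (W t `^ q^-1)%E.
Proof.
rewrite /Lq_primitive Lq_normE//; congr (_ `^ _)%E; apply: eq_integral => u.
rewrite inE/= in_itv/= => /andP[u0 _].
have /fineK bu := slowly_varying_fin_num b_sv u0.
rewrite abseM poweRM// -[in `|b u|%E]bu !abse_EFin !poweR_EFin -EFinM.
rewrite !ger0_norm ?powR_ge0//; last by rewrite fine_ge0// ltW// (sv_gt0 b_sv).
by rewrite -powRrM mulNr mulVf// powR_inv1 ?ltW// mulrC.
Qed.

Let W1 : (W 1%R < +oo)%E.
Proof.
by move: b_fin; rewrite -/(Lq_primitive q b 1) Lq_primitiveE => /lty_poweRy;
  apply; rewrite invr_eq0.
Qed.

Let Wfin t : W t \is a fin_num.
Proof. exact: sv_primitive_fin_num. Qed.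

Let W_ge0 t : (0 <= W t)%E.
Proof. by apply: (@sv_integral_ge0 _ _ b_sv q `]0, t[); exact: lexx. Qed.

Lemma Lq_primitive_fin_num t : B t \is a fin_num.
Proof. by rewrite Lq_primitiveE fin_num_poweR. Qed.

Lemma Lq_primitive_ge0 t : (0 <= B t)%E.
Proof. by rewrite Lq_primitiveE poweR_ge0. Qed.

Lemma le_Lq_primitive s t : s <= t -> (B s <= B t)%E.
Proof.
move=> st; rewrite !Lq_primitiveE; apply: le_poweR => //.
  by rewrite invr_ge0 ltW.
apply: (@le_sv_integral _ _ b_sv q `]0, s[ `]0, t[); first exact: lexx.
by apply: subset_itvl; rewrite bnd_simp.
Qed.

(** The 1/q-th power of the growth of W with exponent e q. Asking for 1 <= c lets the same constant
    serve both directions of the equivalence in [slowly_varying_Lq_primitive]. *)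
Lemma Lq_primitive_growth e : 0 < e -> exists2 c : R, 1 <= c &
  forall s t, 0 < s -> s <= t ->
    ((t `^ (- e))%:E * B t <= c%:E * ((s `^ (- e))%:E * B s))%E.
Proof.
move=> e0; have eq0 : 0 < e * q by rewrite mulr_gt0.
have [c c0 h] := sv_primitive_growth b_sv q0 eq0.
exists (Num.max 1 (c `^ q^-1)); first by rewrite le_max lexx.
move=> s t s0 st; have t0 := lt_le_trans s0 st.
have ts0 : 0 <= t / s by exact/ltW/divr_gt0.
apply: (@le_trans _ _ ((c `^ q^-1)%:E * ((s `^ (- e))%:E * B s))%E); last first.
  apply: lee_wpmul2r; first by rewrite mule_ge0 ?Lq_primitive_ge0 ?lee_fin
    ?powR_ge0.
  by rewrite lee_fin le_max lexx orbT.
have : (B t <= (c `^ q^-1 * (t / s) `^ e)%:E * B s)%E.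
  rewrite !Lq_primitiveE.
  have -> : c `^ q^-1 * (t / s) `^ e = (c * (t / s) `^ (e * q)) `^ q^-1.
    by rewrite (powRM q^-1) ?powR_ge0 ?(ltW c0)// -powRrM mulfK.
  rewrite -poweR_EFin -poweRM ?lee_fin ?mulr_ge0 ?powR_ge0 ?(ltW c0)//.
  apply: le_poweR; [by rewrite invr_ge0 ltW|exact: W_ge0|exact: h].
rewrite -(lee_pmul2l _ (_ : (0 < (t `^ (- e))%:E)%E)) ?lte_fin ?powR_gt0//.
move=> /le_trans; apply; rewrite !muleA -!EFinM le_eqVlt; apply/orP; left.
apply/eqP; congr (_%:E * _)%E.
rewrite powRM ?invr_ge0 ?(ltW t0) ?(ltW s0)// powRV ?(ltW s0)//.
rewrite mulrCA; congr (_ * _).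
by rewrite mulrA -powRD ?(gt_eqF t0) ?implybT// addNr powRr0 mul1r.
Qed.

Lemma slowly_varying_Lq_primitive : slowly_varying B.
Proof.
split.
- apply: emeasurable_nondecreasing; first exact: interval_is_interval.
  by move=> s t _ _; exact: le_Lq_primitive.
- by move=> t t0; rewrite Lq_primitiveE poweR_gt0// sv_primitive_gt0.
- exists 1 => //; rewrite -ltey.
  by have := Lq_primitive_fin_num 1; rewrite ge0_fin_numE ?Lq_primitive_ge0.
- move=> e e0; exists (fun t => (t `^ e)%:E * B t)%E.
    move=> s t; rewrite !in_itv/= !andbT => s0 t0 st.
    apply: lee_pmul; rewrite ?lee_fin ?powR_ge0 ?Lq_primitive_ge0//.
      by rewrite ge0_ler_powR ?nnegrE// ltW.
    exact: le_Lq_primitive.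
  by exists 1 => // t t0; rewrite !mul1e.
move=> e e0; have [c c1 h] := Lq_primitive_growth e0.
pose F t := ((t `^ (- e))%:E * B t)%E.
(* The least nonincreasing majorant of t^(-e) B(t); the growth bound keeps it within the factor
   c. *)
pose G t := ereal_sup [set F u | u in [set u | t <= u]].
exists G.
  move=> s t _ _ st; apply: ereal_sup_le => _ [u /= tu <-].
  by exists u => //=; exact: le_trans tu.
exists c; first exact: lt_le_trans c1.
move=> t t0; split; last by apply: ge_ereal_sup => _ [u /= tu <-]; exact: h.
have F0 : (0 <= F t)%E by rewrite mule_ge0 ?Lq_primitive_ge0 ?lee_fin ?powR_ge0.
have Fs : (F t <= G t)%E.
  by apply: ereal_sup_ubound; exists t => //=.
apply: (le_trans Fs); apply: lee_pemull; last by rewrite lee_fin.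
exact: le_trans F0 Fs.
Qed.

End Lq_primitive_slowly_varying.

(** * From J-representations to the K-norm *)

Section powR_subadditive.
Context {R : realType} (q : R) (q0 : 0 < q) (q1 : q <= 1).

(** Divided by x + y, each summand becomes some z in [0, 1], and z <= z^q because q <= 1. *)
Lemma powR_subadditive (x y : R) : 0 <= x -> 0 <= y ->
  (x + y) `^ q <= x `^ q + y `^ q.
Proof.
move=> x0 y0; have := addr_ge0 x0 y0; rewrite le_eqVlt => /predU1P[<-|xy0].
  by rewrite powR0 ?gt_eqF// addr_ge0 ?powR_ge0.
have h z : 0 <= z -> z <= x + y -> z / (x + y) * (x + y) `^ q <= z `^ q.
  rewrite le_eqVlt => /predU1P[<- _|z0 zxy]; first by rewrite !mul0r powR_ge0.
  have zxy0 : 0 < z / (x + y) by rewrite divr_gt0.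
  rewrite (_ : z `^ q = (z / (x + y)) `^ q * (x + y) `^ q); last first.
    by rewrite -powRM ?divfK ?gt_eqF// ltW.
  rewrite ler_pM2r ?powR_gt0//; apply: ger1_powR => //.
  by rewrite zxy0 ler_pdivrMr// mul1r.
have -> : (x + y) `^ q = x / (x + y) * (x + y) `^ q + y / (x + y) * (x + y) `^ q.
  by rewrite -mulrDl -mulrDl divff ?mul1r// gt_eqF.
by apply: lerD; apply: h => //; rewrite ?lerDl ?lerDr.
Qed.

Lemma powR_subadditive_sum (x : nat -> R) n : (forall i, 0 <= x i) ->
  (\sum_(0 <= i < n) x i) `^ q <= \sum_(0 <= i < n) x i `^ q.
Proof.
move=> x0; elim: n => [|n IH]; first by rewrite !big_geq// powR0// gt_eqF.
rewrite !big_nat_recr//=; apply: le_trans (powR_subadditive _ _) _ => //.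
  exact: sumr_ge0.
by rewrite lerD2r.
Qed.

End powR_subadditive.

Section int_sums.
Context {R : realType}.

(** Pairing n with -(n + 1) turns the unordered sum into a series, for which termwise integration is
    available. *)
Lemma esum_int (a : int -> \bar R) : (forall k, 0 <= a k)%E ->
  (\esum_(k in [set: int]) a k = \sum_(0 <= n <oo) (a (Posz n) + a (Negz n)))%E.
Proof.
move=> a0; rewrite nneseriesD//.
have posE : [set: int] `&` range Posz = Posz @` [set: nat] by rewrite setTI.
have negE : [set: int] `&` ~` range Posz = Negz @` [set: nat].
  rewrite setTI; apply/seteqP; split => [[n|n] /=|_ [n _ <-] [m _]//].
    by case; exists n.
  by move=> _; exists n.
rewrite (esumID (range Posz))// posE negE !esum_image; last 2 first.
- by move=> m n _ _ [].
- by move=> m n _ _ [].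
by rewrite !nneseries_esumT.
Qed.

End int_sums.

(** * The K-norm as an integral, and its kernel *)

Section K_norm.
Context {R : realType} {V : lmodType R} (X0 X1 : normed_subset V).
Hypotheses (sn0 : is_seminormed X0) (sn1 : is_seminormed X1).
Context (b : R -> \bar R) (b_sv : slowly_varying b) (q : R) (q0 : 0 < q).
Local Notation mu := (@completed_lebesgue_measure R).
Local Notation w := (sv_pow b q).
Local Notation W t := (sv_integral b q `]0, t[%classic).
Local Notation pos := (`]0%R, +oo[%classic : set (lebesgueType R)).
Implicit Types (s t : R) (f : V).

(* [fine] makes it 0 when f is outside of X0 + X1. *)
Definition Kval f t : R := fine (Kfun X0 X1 t f).
Definition Kdensity f t : R := t `^ (- q) * w t / t * Kval f t `^ q.

Let qN0 : q != 0. Proof. by rewrite gt_eqF. Qed.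

Lemma Kval_ge0 f t : 0 <= t -> 0 <= Kval f t.
Proof. by move=> t0; rewrite fine_ge0// Kfun_ge0. Qed.

Lemma KvalE f t : sum_carrier X0 X1 f -> 0 <= t ->
  (Kval f t)%:E = Kfun X0 X1 t f.
Proof. by move=> Sf t0; rewrite fineK// Kfun_fin_num. Qed.

Lemma KnormE f : sum_carrier X0 X1 f -> Knorm X0 X1 q b f =
  ((\int[mu]_(t in pos) (Kdensity f t)%:E) `^ q^-1)%E.
Proof.
move=> Sf; rewrite /Knorm Lq_normE//; congr (_ `^ _)%E; apply: eq_integral => t.
rewrite inE/= in_itv/= andbT => t0.
rewrite -KvalE ?(ltW t0)//; have K0 := Kval_ge0 f (ltW t0).
have /fineK bt := slowly_varying_fin_num b_sv t0.
have b0 : 0 <= fine (b t) by rewrite fine_ge0// ltW// (sv_gt0 b_sv).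
rewrite -bt -!EFinM abse_EFin poweR_EFin ger0_norm ?mulr_ge0 ?powR_ge0//.
rewrite !(powRM q) ?mulr_ge0 ?powR_ge0// -powRrM.
congr (_%:E); rewrite /Kdensity /sv_pow; congr (_ * _); rewrite mulrAC;
  congr (_ * _).
rewrite mulrBl mulN1r mulVf// powRB; last by rewrite (gt_eqF t0) implybT.
by rewrite powRr1// ltW.
Qed.

Lemma Kdensity_ge0 f t : pos t -> (0 <= (Kdensity f t)%:E)%E.
Proof.
rewrite /= in_itv/= andbT => t0.
by rewrite lee_fin !mulr_ge0 ?powR_ge0 ?invr_ge0// ltW.
Qed.

Lemma measurable_Kdensity f : sum_carrier X0 X1 f ->
  measurable_fun pos (fun t => (Kdensity f t)%:E).
Proof.
move=> Sf.
suff : measurable_fun pos (fun t => (t `^ (- q) * w t / t)%:E * (Kval f t `^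
  q)%:E)%E.
  by apply: eq_measurable_fun => t _; rewrite -EFinM.
apply: emeasurable_funM; first exact: measurable_sv_weight.
apply: emeasurable_nondecreasing; first exact: interval_is_interval.
move=> s t; rewrite !inE/= !in_itv/= !andbT => s0 t0 st.
rewrite lee_fin; apply: ge0_ler_powR;
  rewrite ?nnegrE ?Kval_ge0 ?(ltW s0) ?(ltW t0) ?(ltW q0)//.
by rewrite -lee_fin !KvalE ?(ltW s0) ?(ltW t0)//; exact: le_Kfun.
Qed.

(** The density of the K-norm with K(t) replaced by min(1, t / a), which bounds K(t, v) when J(a, v)
    <= 1. *)
Definition kernel a t : R := t `^ (- q) * w t / t * Num.min 1 (t / a) `^ q.

Lemma kernel_ge0 a t : pos t -> 0 <= kernel a t.
Proof.
rewrite /= in_itv/= andbT => t0.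
by rewrite !mulr_ge0 ?powR_ge0 ?invr_ge0// ltW.
Qed.

Lemma measurable_kernel a : 0 < a ->
  measurable_fun pos (fun t => (kernel a t)%:E).
Proof.
move=> a0.
suff : measurable_fun pos
    (fun t => (t `^ (- q) * w t / t)%:E * (Num.min 1 (t / a) `^ q)%:E)%E.
  by apply: eq_measurable_fun => t _; rewrite -EFinM.
apply: emeasurable_funM; first exact: measurable_sv_weight.
apply: emeasurable_nondecreasing; first exact: interval_is_interval.
move=> s t; rewrite !inE/= !in_itv/= !andbT => s0 t0 st.
have m0 u : 0 < u -> 0 <= Num.min 1 (u / a) by move=> u0;
  rewrite le_min ler01/= divr_ge0// ltW.
rewrite lee_fin; apply: ge0_ler_powR; rewrite ?nnegrE ?m0 ?(ltW q0)//.
by apply: le_min2 => //; rewrite ler_pM2r// invr_gt0.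
Qed.

(** Below a the factor (t / a)^q cancels t^(-q) and leaves exactly a^(-q) W(a); above a the minimum
    is 1 and the tail estimate applies. Hence 1 + c. *)
Lemma integral_kernel_le : exists2 c : R, 0 < c & forall a, 0 < a ->
  (\int[mu]_(t in pos) (kernel a t)%:E <= (c * a `^ (- q))%:E * W a)%E.
Proof.
have [c c0 h] := sv_integral_tail b_sv q0.
exists (1 + c); first by rewrite addr_gt0.
move=> a a0.
pose lo : set (lebesgueType R) := `]0, a[%classic.
pose hi : set (lebesgueType R) := `[a, +oo[%classic.
have UE : pos = lo `|` hi by rewrite /lo /hi -itv_bndbnd_setU.
have mlo : measurable lo by exact: measurable_itv_lebesgueType.
have mhi : measurable hi by exact: measurable_itv_lebesgueType.
have W0 : (0 <= W a)%E by apply: (@sv_integral_ge0 _ _ b_sv q `]0, a[);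
  exact: lexx.
rewrite UE ge0_integral_setU; first last.
- rewrite disj_set2E; apply/eqP; rewrite -subset0 => u [].
  by rewrite /lo /hi/= !in_itv/= => /andP[_ ua]; rewrite leNgt ua.
- by rewrite -UE => t t0; rewrite lee_fin kernel_ge0.
- by rewrite -UE; exact: measurable_kernel.
- exact: mhi.
- exact: mlo.
rewrite mulrDl mul1r EFinD ge0_muleDl; last 2 first.
- by rewrite lee_fin powR_ge0.
- by rewrite lee_fin mulr_ge0 ?powR_ge0// ltW.
apply: leeD.
  rewrite /sv_integral -ge0_integralZl_EFin.
  - rewrite le_eqVlt; apply/orP; left; apply/eqP; apply: eq_integral => t.
    rewrite inE /lo/= in_itv/= => /andP[t0 ta]; rewrite -EFinM; congr EFin.
    rewrite /kernel min_r; last by rewrite ler_pdivrMr// mul1r ltW.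
    rewrite powRM ?invr_ge0 ?(ltW t0) ?(ltW a0)// powRV ?(ltW a0)//.
    have tt : t `^ (- q) * t `^ q = 1.
      by rewrite -powRD ?addNr ?powRr0// (gt_eqF t0) implybT.
    transitivity ((t `^ (- q) * t `^ q) * (a `^ (- q) * (w t / t)));
      first by ring.
    by rewrite tt mul1r.
  - exact: mlo.
  - move=> t; rewrite /lo/= in_itv/= => /andP[t0 _]; apply: (sv_density_ge0 b_sv).
    by rewrite /= in_itv/= t0.
  - by apply: (@measurable_sv_density_sub _ _ b_sv q `]0, a[); exact: lexx.
  - exact: powR_ge0.
apply: le_trans (h a a0); rewrite le_eqVlt; apply/orP; left.
apply/eqP; apply: eq_integral => t; rewrite inE /hi/= in_itv/= andbT => ta.
by rewrite /kernel min_l ?powR1 ?mulr1// ler_pdivlMr// mul1r.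
Qed.

End K_norm.

Section J_to_K.
Context {R : realType} {V : lmodType R} (X0 X1 : normed_subset V).
Hypotheses (sn0 : is_seminormed X0) (sn1 : is_seminormed X1).
Context (b : R -> \bar R) (b_sv : slowly_varying b).
Context (q : R) (q0 : 0 < q) (q1 : q <= 1).
Local Notation mu := (@completed_lebesgue_measure R).
Local Notation w := (sv_pow b q).
Local Notation W t := (sv_integral b q `]0, t[%classic).
Local Notation B := (Lq_primitive q b).
Local Notation G0 := (gagliardo X0 X1 X0).
Local Notation G1 := (gagliardo X0 X1 X1).
Local Notation pos := (`]0%R, +oo[%classic : set (lebesgueType R)).
Local Notation J k u := (Jfun G0 G1 (2 ^ k) u).
Implicit Types (t : R) (f : V) (k : int) (u : int -> V).

Let qN0 : q != 0. Proof. by rewrite gt_eqF. Qed.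

Let X0S : carrier X0 `<=` sum_carrier X0 X1.
Proof. by move=> f; exact: sum_carrierl. Qed.

Let exp2_gt0 k : 0 < 2 ^ k :> R. Proof. exact: exprz_gt0. Qed.

Lemma Jfun_gagliardo_ge0 k f : 0 <= J k f.
Proof. by rewrite le_max (gagliardo_ge0 X0 X1 sn0). Qed.

Lemma Kval_le_Jfun t k f : 0 < t -> carrier G0 f -> carrier G1 f ->
  Kval X0 X1 f t <= Num.min 1 (t / 2 ^ k) * J k f.
Proof.
move=> t0 G0f G1f; have Sf : sum_carrier X0 X1 f by exact: G0f.1.
rewrite -lee_fin (KvalE sn0 sn1)// ?(ltW t0)//.
case: (leP 1 (t / 2 ^ k)) => _.
  rewrite mul1r; apply: le_trans (Kfun_le_gagliardo0 sn0 sn1 (ltW t0) G0f) _.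
  by rewrite lee_fin le_max lexx.
apply: le_trans (Kfun_le_gagliardo1 sn0 sn1 t0 G1f) _.
rewrite lee_fin -mulrA ler_pM2l// ler_pdivlMl//.
by rewrite le_max lexx orbT.
Qed.

(** The negative indices run from 1 and stop before the first bound, so [N.+1] there matches the N
    terms with [Negz n] = -(n + 1). *)
Lemma two_sided_partial_sum_diag u N :
  two_sided_partial_sum u (N.+1, N) = \sum_(0 <= n < N) (u (Posz n) + u (Negz n)).
Proof.
rewrite /two_sided_partial_sum/= big_add1/= addrC -big_split/=.
by apply: eq_bigr => n _; rewrite NegzE.
Qed.

Lemma Kfun_sum t (x : nat -> V) N : 0 <= t ->
  (forall n, sum_carrier X0 X1 (x n)) ->
  sum_carrier X0 X1 (\sum_(0 <= n < N) x n) /\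
  Kval X0 X1 (\sum_(0 <= n < N) x n) t <= \sum_(0 <= n < N) Kval X0 X1 (x n) t.
Proof.
move=> t0 Sx; elim: N => [|N [IH1 IH2]].
  rewrite !big_geq//; have X00 := carrier0 sn0; split; first exact: X0S.
  rewrite -lee_fin (KvalE sn0 sn1)//; last exact: X0S.
  by apply: le_trans (Kfun_le0 _ _ _) _ => //; rewrite nrm0.
rewrite !big_nat_recr//=; split; first exact: sum_carrierD.
rewrite -lee_fin EFinD.
rewrite (KvalE sn0 sn1)//; last exact: sum_carrierD.
apply: le_trans (KfunD sn0 sn1 t0 IH1 (Sx N)) _.
by rewrite -!(KvalE sn0 sn1)// leeD2r// lee_fin.
Qed.

(** f is split into a diagonal partial sum and a remainder. The remainder is small in the sum of the
    completed spaces, hence small for K(t) of the original couple, the two K-functionals being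
    equal. *)
Lemma Kval_powR_le_esum f u t : 0 < t -> sum_carrier X0 X1 f ->
  J_representation G0 G1 f u ->
  ((Kval X0 X1 f t `^ q)%:E <= \esum_(k in [set: int]) (Kval X0 X1 (u k) t `^
    q)%:E)%E.
Proof.
move=> t0 Sf [Gu cu]; have Su k : sum_carrier X0 X1 (u k) by have [[]] := Gu k.
pose S N := \sum_(0 <= n < N) (u (Posz n) + u (Negz n)).
have SS N : sum_carrier X0 X1 (S N).
  by have [] := @Kfun_sum t _ N (ltW t0) (fun n => sum_carrierD sn0 sn1 (Su
    (Posz n)) (Su (Negz n))).
have c0 : 0 < Num.max 1 t by rewrite lt_max ltr01.
have small e : 0 < e -> exists N, Kval X0 X1 (f - S N) t <= e.
  move=> e0; have : 0 < e / Num.max 1 t by rewrite divr_gt0.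
  move=> /(cvge0_lt)/(_ cu) [[P Q] [[m _ mP] [n _ nQ]] PQ].
  (* Convergence provides independent thresholds for the two ends; a diagonal partial sum beyond
     both suffices. *)
  exists (maxn m n); rewrite -lee_fin (KvalE sn0 sn1) ?(ltW t0)//;
    last exact: sum_carrierB.
  apply: le_trans (Kfun_le_max1 sn0 sn1 (ltW t0) _) _; first exact: sum_carrierB.
  have /= := PQ ((maxn m n).+1, maxn m n) (conj (mP _ _) (nQ _ _)).
  rewrite two_sided_partial_sum_diag /sum_norm (Kfun_gagliardo sn0 sn1)// => h.
  rewrite -lee_pdivlMl//= -EFinM mulrC ltW// h//=.
    by rewrite leqW// leq_maxl.
  exact: leq_maxr.
apply/lee_addgt0Pr => d d0.
(* The remainder is kept below d^(1/q), so that its q-th power is at most the allowed error d. *)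
have [|N hN] := small (d `^ q^-1); first exact: powR_gt0.
have K0 g : 0 <= Kval X0 X1 g t by exact/Kval_ge0/ltW.
apply: (@le_trans _ _ (Kval X0 X1 (S N) t `^ q + d)%:E).
  rewrite lee_fin; apply: (@le_trans _ _ ((Kval X0 X1 (S N) t + d `^ q^-1) `^ q)).
    apply: ge0_ler_powR; rewrite ?nnegrE ?addr_ge0 ?powR_ge0 ?(ltW q0)//.
    apply: (@le_trans _ _ (Kval X0 X1 (S N) t + Kval X0 X1 (f - S N) t));
      last by rewrite lerD2l.
    have SfS : sum_carrier X0 X1 (f - S N) by exact: sum_carrierB.
    rewrite -lee_fin EFinD !(KvalE sn0 sn1)// ?(ltW t0)//.
    by rewrite {1}(_ : f = S N + (f - S N)) ?KfunD ?(ltW t0)// addrC subrK.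
  apply: le_trans (powR_subadditive q0 q1 _ _) _; rewrite ?powR_ge0//.
  by rewrite -[in leLHS]powRrM mulVf// powRr1// ltW.
rewrite EFinD leeD2r// esum_int; last by move=> k; rewrite lee_fin powR_ge0.
apply: (@le_trans _ _ (\sum_(0 <= n < N)
    (Kval X0 X1 (u (Posz n)) t `^ q + Kval X0 X1 (u (Negz n)) t `^ q))%:E).
  rewrite lee_fin.
  have [_ h] := @Kfun_sum t _ N (ltW t0) (fun n => sum_carrierD sn0 sn1 (Su
    (Posz n)) (Su (Negz n))).
  apply: (@le_trans _ _ ((\sum_(0 <= n < N)
      (Kval X0 X1 (u (Posz n)) t + Kval X0 X1 (u (Negz n)) t)) `^ q)).
    apply: ge0_ler_powR; rewrite ?nnegrE ?(ltW q0)//.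
      by apply: sumr_ge0 => n _; rewrite addr_ge0.
    apply: (le_trans h); apply: ler_sum => n _.
    rewrite -lee_fin EFinD !(KvalE sn0 sn1)// ?(ltW t0)//;
      last exact: sum_carrierD.
    by apply: KfunD => //; exact: ltW.
  apply: le_trans (powR_subadditive_sum q0 q1 _ _) _; first by move=> n;
    rewrite addr_ge0.
  by apply: ler_sum => n _; exact: powR_subadditive.
rewrite -sumEFin; under eq_bigr do rewrite EFinD.
by apply: nneseries_lim_ge => n _ _; rewrite adde_ge0// lee_fin powR_ge0.
Qed.

Lemma J_sizeE u : J_size G0 G1 q B u =
  ((\esum_(k in [set: int]) (((2 ^ k) `^ (- q) * J k (u k) `^ q)%:E * W (2 ^
    k)%R)) `^ q^-1)%E.
Proof.
rewrite /J_size; congr (_ `^ _)%E; apply: eq_esum => k _.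
have W0 : (0 <= W (2 ^ k)%R)%E
  by apply: (@sv_integral_ge0 _ _ b_sv q `]0, 2 ^ k[); exact: lexx.
have J0 := Jfun_gagliardo_ge0 k (u k).
have e0 := exp2_gt0 (- k).
rewrite (Lq_primitiveE b_sv q0) !poweRM ?mule_ge0 ?poweR_ge0 ?lee_fin ?(ltW e0)//.
rewrite poweRK// !poweR_EFin muleAC -EFinM; congr (_%:E * _)%E; congr (_ * _).
by rewrite -invr_expz powRV// ltW.
Qed.

(** After termwise integration the k-th term is J^q times a kernel integral with a = 2^k, at most c
    2^(-kq) W(2^k), which is the weight of that term in the J-size. *)
Lemma Knorm_le_J_size : exists2 c : R, 0 < c & forall f u,
  sum_carrier X0 X1 f -> J_representation G0 G1 f u ->
  (Knorm X0 X1 q b f <= c%:E * J_size G0 G1 q B u)%E.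
Proof.
have [c c0 hc] := integral_kernel_le b_sv q0.
exists (c `^ q^-1); first exact: powR_gt0.
move=> f u Sf Ju; rewrite (KnormE sn0 sn1 b_sv)// J_sizeE -poweR_EFin.
set E := (\esum_(_ in _) _)%E.
have W0 k : (0 <= W (2 ^ k)%R)%E
  by apply: (@sv_integral_ge0 _ _ b_sv q `]0, 2 ^ k[); exact: lexx.
have c'0 k : 0 <= (2 ^ k) `^ (- q) * J k (u k) `^ q by rewrite mulr_ge0 ?powR_ge0.
have E0 : (0 <= E)%E by apply: esum_ge0 => k _; rewrite mule_ge0 ?lee_fin.
rewrite -poweRM ?lee_fin ?(ltW c0)//; apply: le_poweR.
- by rewrite invr_ge0 ltW.
- by apply: integral_ge0 => t; exact: Kdensity_ge0.
pose g k t := ((J k (u k) `^ q)%:E * (kernel b q (2 ^ k) t)%:E)%E.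
have g0 k t : pos t -> (0 <= g k t)%E.
  by move=> t0; rewrite mule_ge0 ?lee_fin ?powR_ge0 ?kernel_ge0.
have mg k : measurable_fun pos (g k).
  by apply: measurable_funeM; exact: measurable_kernel.
have mpos : measurable pos by exact: measurable_itv_lebesgueType.
pose h n t := (g (Posz n) t + g (Negz n) t)%E.
have h0 n t : pos t -> (0 <= h n t)%E by move=> t0; rewrite adde_ge0 ?g0.
have mh n : measurable_fun pos (h n) by apply: emeasurable_funD.
apply: (@le_trans _ _ (\int[mu]_(t in pos) (\sum_(n <oo) h n t))%E).
  apply: ge0_le_integral.
  - exact: mpos.
  - by move=> t; exact: Kdensity_ge0.
  - exact: measurable_Kdensity.
  - by apply: ge0_emeasurable_sum => [n t pt _|n _]; [exact: h0|exact: mh].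
  move=> t pt; have t0 : 0 < t by move: pt; rewrite /= in_itv/= andbT.
  have hK := Kval_powR_le_esum t0 Sf Ju.
  have wt0 : 0 <= t `^ (- q) * w t / t.
    by rewrite !mulr_ge0 ?invr_ge0 ?powR_ge0// ltW.
  rewrite /Kdensity EFinM; apply: (le_trans (lee_wpmul2l _ hK));
    first by rewrite lee_fin.
  rewrite esum_int; last by move=> k; rewrite lee_fin powR_ge0.
  rewrite -nneseriesZl//; last by move=> n _; rewrite adde_ge0// lee_fin powR_ge0.
  apply: lee_nneseries => [n _ _|n _].
    by rewrite mule_ge0 ?adde_ge0 ?lee_fin ?powR_ge0.
  have H k : ((t `^ (- q) * w t / t)%:E * (Kval X0 X1 (u k) t `^ q)%:E <=
    g k t)%E.
    rewrite /g /kernel -!EFinM lee_fin mulrCA; apply: ler_wpM2l => //.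
    have m0 : 0 <= Num.min 1 (t / 2 ^ k) by rewrite le_min ler01/= divr_ge0// ltW.
    rewrite -powRM ?Jfun_gagliardo_ge0//.
    apply: ge0_ler_powR; rewrite ?nnegrE ?(ltW q0) ?Kval_ge0 ?mulr_ge0
      ?Jfun_gagliardo_ge0 ?(ltW t0)//.
    by rewrite mulrC; apply: Kval_le_Jfun => //; have [[]] := Ju.1 k.
  rewrite ge0_muleDr; first exact: (leeD (H _) (H _)).
    by rewrite lee_fin powR_ge0.
  by rewrite lee_fin powR_ge0.
rewrite integral_nneseries//.
apply: (@le_trans _ _ (\sum_(n <oo) (\int[mu]_(t in pos) g (Posz n) t +
  \int[mu]_(t in pos) g (Negz n) t))%E).
  apply: lee_nneseries => [n _ _|n _]; first by apply: integral_ge0 => t;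
    exact: h0.
  rewrite ge0_integralD//; [exact: g0|exact: g0].
rewrite -[leLHS](@esum_int _ (fun k => \int[mu]_(t in pos) g k t)%E); last first.
  by move=> k; apply: integral_ge0 => t; exact: g0.
rewrite /E !esum_int; first last.
- by move=> k; apply: integral_ge0 => t; exact: g0.
- by move=> k; rewrite mule_ge0 ?lee_fin.
rewrite -nneseriesZl//; last by move=> n _; rewrite adde_ge0// mule_ge0 ?lee_fin.
apply: lee_nneseries => [n _ _|n _].
  by rewrite adde_ge0//; apply: integral_ge0 => t; exact: g0.
have H k : (\int[mu]_(t in pos) g k t <=
    c%:E * (((2 ^ k) `^ (- q) * J k (u k) `^ q)%:E * W (2 ^ k)%R))%E.
  rewrite /g ge0_integralZl_EFin.
  - rewrite (mulrC ((2 ^ k) `^ (- q))) EFinM -muleA [leRHS]muleCA;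
    apply: lee_wpmul2l.
      by rewrite lee_fin powR_ge0.
    by rewrite muleA -EFinM; apply: hc.
  - exact: mpos.
  - by move=> t pt; rewrite lee_fin kernel_ge0.
  - exact: measurable_kernel.
  - exact: powR_ge0.
by rewrite ge0_muleDr ?mule_ge0 ?lee_fin//; apply: leeD; exact: H.
Qed.

End J_to_K.

(** * From the K-norm to J-representations *)

Section dyadic_levels.
Context {R : realType}.

(** l is the floor of -log_2 x, and rounding down makes the upper bound strict. *)
Lemma exists_dyadic_level (x : R) : 0 < x ->
  exists l : int, x <= 2 ^ (- l) /\ 2 ^ (- l) < 2 * x.
Proof.
move=> x0; have l2 : 0 < ln (2 : R) by rewrite ln_gt0// ltr1n.
pose y := - ln x / ln 2; exists (Num.floor y).
have E z : (2 : R) ^ z = expR (z%:~R * ln 2).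
  by rewrite -powR_intmul// /powR pnatr_eq0/=.
have xE : x = expR (ln x) by rewrite lnK.
rewrite E mulrNz; split.
  rewrite [leLHS]xE ler_expR mulNr lerNr -ler_pdivlMr//.
  exact: floor_le.
have -> : 2 * x = expR (ln 2 + ln x) by rewrite expRD !lnK// posrE.
rewrite ltr_expR; have : y < (Num.floor y)%:~R + 1.
  by have := floorD1_gt y; rewrite intrD.
by rewrite /y ltr_pdivrMr// mulrDl mul1r; lra.
Qed.

Context (psi : int -> R).
Hypothesis psi_gt0 : forall k, 0 < psi k.
Hypothesis psi_le : forall k, psi (k + 1) <= psi k.
Hypothesis psi_ge : forall k, psi k <= 2 * psi (k + 1).

(** The strict bound 2^(-l) < 2 psi, compared at k and k + 1, gives strict inequalities between
    integer exponents; these exclude every step of l other than 0 and 1. *)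
Lemma exists_dyadic_levels : exists l : int -> int,
  (forall k, psi k <= 2 ^ (- l k) /\ 2 ^ (- l k) < 2 * psi k) /\
  (forall k, l (k + 1) = l k \/ l (k + 1) = l k + 1).
Proof.
have [l hl] := choice (fun k => exists_dyadic_level (psi_gt0 k)).
exists l; split => // k; have [k1 k2] := hl k; have [k3 k4] := hl (k + 1).
have exp2S z : 2 * 2 ^ z = 2 ^ (1 + z) :> R by rewrite exprzDr ?unitfE// expr1z.
have exp2_lt (y z : int) : (2 ^ y < 2 ^ z :> R) ->
  y < z by rewrite ltr_eXz2l// ltr1n.
have h1 : - l (k + 1) < 1 + - l k.
  apply: exp2_lt; rewrite -exp2S; apply: (lt_le_trans k4); rewrite ler_pM2l//.
  exact: le_trans (psi_le k) k1.
have h2 : - l k < 1 + (1 + - l (k + 1)).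
  apply: exp2_lt; rewrite -!exp2S; apply: (lt_le_trans k2); rewrite ler_pM2l//.
  by apply: (le_trans (psi_ge k)); rewrite ler_pM2l.
lia.
Qed.

End dyadic_levels.

Section level_crossing.
Context (l : int -> int).
Hypothesis lS : forall k, l (k + 1) = l k \/ l (k + 1) = l k + 1.

Lemma levels_mono j k : j <= k -> l j <= l k.
Proof.
move=> jk; have -> : k = j + `|k - j|%N by lia.
elim: `|k - j|%N => [|n IH]; first by rewrite addr0.
by have := lS (j + n); rewrite -addrA -PoszD addn1 => -[->|->]; lia.
Qed.

(** A discrete intermediate value theorem: with steps 0 or 1, l reaches the value l k from below
    only out of l k - 1. *)
Lemma level_crossing j k : l j < l k ->
  exists i, [/\ j <= i, i < k, l i = l k - 1 & l (i + 1) = l k].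
Proof.
move=> ljk; have jk : j < k.
  by rewrite ltNge; apply/negP => /levels_mono; rewrite leNgt ljk.
have kE : k = j + `|k - j|%N by lia.
move: ljk; rewrite {jk}kE; elim: `|k - j|%N => [|n IH].
  by rewrite addr0 ltxx.
have -> : j + n.+1 = j + n + 1 by lia.
have [E|E] := lS (j + n); rewrite E => h.
  by have [i [? ? ? ?]] := IH h; exists i; split => //; lia.
by exists (j + n); split; [rewrite lerDl|rewrite ltrDl|rewrite addrK|exact: E].
Qed.

(** By monotonicity a level once left is never met again, so a jump is determined by its level. *)
Lemma level_crossing_uniq i j : l i = l j ->
  l (i + 1) = l i + 1 -> l (j + 1) = l j + 1 -> i = j.
Proof.
move=> ij li lj; case: (ltgtP i j) => // h.
  have : i + 1 <= j by lia.
  by move=> /levels_mono; lia.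
have : j + 1 <= i by lia.
by move=> /levels_mono; lia.
Qed.

End level_crossing.

Section two_sided_telescope.

Lemma telescope_int (V : zmodType) (g : int -> V) N :
  \sum_(0 <= n < N) (g (- n%:Z) - g (- n%:Z - 1)) = g 0 - g (- N%:Z).
Proof.
elim: N => [|N IH]; first by rewrite big_geq// oppr0 subrr.
rewrite big_nat_recr//= IH addrA subrK; congr (_ - g _); lia.
Qed.

Lemma telescope_nat (V : zmodType) (g : int -> V) N :
  \sum_(0 <= n < N) (g (n%:Z + 1) - g n%:Z) = g N%:Z - g 0.
Proof.
elim: N => [|N IH]; first by rewrite big_geq// subrr.
rewrite big_nat_recr//= IH addrC addrA subrK; congr (g _ - _); lia.
Qed.

(** The sum collapses to h(-N) - h(N), where h(-N) <= M and h(N) >= 0. *)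
Lemma two_sided_telescope (R : realDomainType) (h : int -> R) (M : R) N :
  (forall k, 0 <= h k <= M) ->
  \sum_(0 <= n < N) ((h (Posz n) - h (Posz n + 1)) + (h (Negz n) - h (Negz n +
    1))) <= M.
Proof.
move=> hM.
suff -> : \sum_(0 <= n < N)
    ((h (Posz n) - h (Posz n + 1)) + (h (Negz n) - h (Negz n + 1))) =
    h (- N%:Z) - h N.
  by have := hM N; have := hM (- N%:Z); lra.
elim: N => [|N IH]; first by rewrite big_geq// oppr0 subrr.
rewrite big_nat_recr//= IH NegzE.
have -> : - N.+1%:Z + 1 = - N%:Z by lia.
have -> : N%:Z + 1 = N.+1 by lia.
by ring.
Qed.

End two_sided_telescope.

Section weighted_sums.
Context {R : realType} (b : R -> \bar R) (b_sv : slowly_varying b) (q : R).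
Local Notation mu := (@completed_lebesgue_measure R).
Local Notation w := (sv_pow b q).
Local Notation W t := (sv_integral b q `]0, t[%classic).
Local Notation pos := (`]0%R, +oo[%classic : set (lebesgueType R)).

(** Exchange of sum and integral: W(a_k) integrates w(t) / t over t < a_k, so the left side is the
    integral of w(t) / t times the sum of the D_k with a_k > t, and F dominates the partial sums of
    the latter. *)
Lemma esum_sv_primitive_le (a : int -> R) (D : int -> R) (F : R -> R) :
  (forall k, 0 <= D k) ->
  measurable_fun pos (fun t => (w t / t * F t)%:E) ->
  (forall t N, 0 < t -> \sum_(0 <= n < N)
     ((if t < a (Posz n) then D (Posz n) else 0) +
      (if t < a (Negz n) then D (Negz n) else 0)) <= F t) ->
  (\esum_(k in [set: int]) ((D k)%:E * W (a k)) <=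
     \int[mu]_(t in pos) (w t / t * F t)%:E)%E.
Proof.
move=> D0 mF DF; pose T k t := if t < a k then D k else 0.
have mpos : measurable pos by exact: measurable_itv_lebesgueType.
have T0 k t : 0 <= T k t by rewrite /T; case: ifP.
have w0 t : pos t -> 0 <= w t / t.
  by move=> /(sv_density_ge0 b_sv q); rewrite lee_fin.
pose g k t := (w t / t * T k t)%:E.
have g0 k t : pos t -> (0 <= g k t)%E.
  by move=> /w0 wt; rewrite lee_fin mulr_ge0.
have mg k : measurable_fun pos (g k).
  suff : measurable_fun pos (fun t => (w t / t)%:E * (T k t)%:E)%E.
    by apply: eq_measurable_fun => t _; rewrite -EFinM.
  apply: emeasurable_funM; first exact: measurable_sv_density.
  apply: emeasurable_nonincreasing; first exact: interval_is_interval.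
  move=> s t _ _ st; rewrite lee_fin /T; case: ifPn => ta.
    by rewrite (le_lt_trans st ta).
  by case: ifP.
have gE k : ((D k)%:E * W (a k) = \int[mu]_(t in pos) g k t)%E.
  rewrite -ge0_integralZl_EFin.
  - rewrite integral_mkcond [RHS]integral_mkcond; apply: eq_integral => t _.
    rewrite /patch !mem_setE !in_itv/= andbT /g /T; case: (ltP 0 t) => //= t0.
    case: ifP => _; first by rewrite -EFinM mulrC.
    by rewrite mulr0.
  - exact: measurable_itv_lebesgueType.
  - move=> t; rewrite /= in_itv/= => /andP[t0 _]; apply: (sv_density_ge0 b_sv).
    by rewrite /= in_itv/= t0.
  - by apply: (@measurable_sv_density_sub _ _ b_sv q `]0, a k[); exact: lexx.
  - exact: D0.
have I0 k : (0 <= \int[mu]_(t in pos) g k t)%E.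
  by apply: integral_ge0 => t; exact: g0.
under eq_esum do rewrite gE.
rewrite esum_int//.
under eq_eseriesr.
  move=> n _; rewrite -ge0_integralD;
    [|exact: mpos|exact: g0|exact: mg|exact: g0|exact: mg].
  over.
have mh n : measurable_fun pos (fun t => g (Posz n) t + g (Negz n) t)%E.
  by apply: emeasurable_funD; exact: mg.
have h0 n t : pos t -> (0 <= g (Posz n) t + g (Negz n) t)%E.
  by move=> pt; rewrite adde_ge0// g0.
rewrite -integral_nneseries; [|exact: mpos|exact: mh|exact: h0].
apply: ge0_le_integral.
- exact: mpos.
- by move=> t pt; apply: nneseries_ge0 => n _ _; exact: h0.
- by apply: ge0_emeasurable_sum => [n t pt _|n _]; [exact: h0|exact: mh].
- exact: mF.
move=> t pt; apply: lime_le.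
  by apply: is_cvg_nneseries => n _ _; exact: h0.
apply: nearW => N; under eq_bigr do rewrite -EFinD -mulrDr.
rewrite sumEFin -mulr_sumr lee_fin ler_wpM2l ?w0//; apply: DF.
by move: pt; rewrite /= in_itv/= andbT.
Qed.

End weighted_sums.

(** * Construction of the J-representation from the jumps of the level *)

Section K_to_J.
Context {R : realType} {V : lmodType R} (X0 X1 : normed_subset V).
Hypotheses (sn0 : is_seminormed X0) (sn1 : is_seminormed X1).
Hypothesis dense0 : forall f (e : R), carrier X0 f -> 0 < e ->
  exists g, [/\ carrier X0 g, carrier X1 g & nrm X0 (f - g) < e].
Hypothesis dense1 : forall f (e : R), carrier X1 f -> 0 < e ->
  exists g, [/\ carrier X0 g, carrier X1 g & nrm X1 (f - g) < e].
Implicit Types (f : V) (t : R) (k : int).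
Local Notation G0 := (gagliardo X0 X1 X0).
Local Notation G1 := (gagliardo X0 X1 X1).
Local Notation J k u := (Jfun G0 G1 (2 ^ k) u).

Let X0S : carrier X0 `<=` sum_carrier X0 X1.
Proof. by move=> f; exact: sum_carrierl. Qed.

Let X1S : carrier X1 `<=` sum_carrier X0 X1.
Proof. by move=> f; exact: sum_carrierr. Qed.

Let exp2_gt0 k : 0 < 2 ^ k :> R. Proof. exact: exprz_gt0. Qed.

Let exp2_ge0 k : 0 <= 2 ^ k :> R. Proof. exact: ltW. Qed.

Let exp2N (n : nat) : 2 ^ (- n%:Z) = (2 ^+ n)^-1 :> R.
Proof. by rewrite -invr_expz. Qed.

Section positive_K.
Context (f : V) (Sf : sum_carrier X0 X1 f).
Hypothesis K_gt0 : forall t, 0 < t -> 0 < Kval X0 X1 f t.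

Let psi k := Kval X0 X1 f (2 ^ k) / 2 ^ k.

Let KvE t : 0 <= t -> (Kval X0 X1 f t)%:E = Kfun X0 X1 t f.
Proof. exact: KvalE. Qed.

Let scale_psi k : 2 ^ k * psi k = Kval X0 X1 f (2 ^ k).
Proof. by rewrite /psi mulrC divfK ?gt_eqF. Qed.

Let psi_gt0 k : 0 < psi k.
Proof. by rewrite divr_gt0// K_gt0. Qed.

Let exp2S k : 2 ^ (k + 1) = 2 * 2 ^ k :> R.
Proof. by rewrite exprzDr ?unitfE// expr1z mulrC. Qed.

Let psi_le k : psi (k + 1) <= psi k.
Proof.
rewrite /psi exp2S ler_pdivrMr ?mulr_gt0// mulrCA divfK ?gt_eqF//.
rewrite -lee_fin EFinM !KvE ?mulr_ge0//.
by apply: Kfun_scale => //; rewrite ler1n.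
Qed.

Lemma le_Kval s t : 0 <= s -> s <= t -> Kval X0 X1 f s <= Kval X0 X1 f t.
Proof.
by move=> s0 st; rewrite -lee_fin !KvE ?(le_trans s0 st)//; exact: le_Kfun.
Qed.

Let psi_ge k : psi k <= 2 * psi (k + 1).
Proof.
rewrite /psi exp2S invfM [X in _ <= _ * X]mulrCA mulVKf ?pnatr_eq0//.
rewrite ler_pM2r ?invr_gt0//; apply: le_Kval => //.
by rewrite ler_peMl ?ler1n// ltW.
Qed.

Let l : int -> int := sval (cid (exists_dyadic_levels psi_gt0 psi_le psi_ge)).

Let lam k : R := 2 ^ (- l k).

Let lam_gt0 k : 0 < lam k. Proof. exact: exp2_gt0. Qed.

Let psi_lam k : psi k <= lam k.
Proof. by rewrite /lam /l; case: cid => /= l' [h _]; have [] := h k. Qed.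

Let lam_psi k : lam k < 2 * psi k.
Proof. by rewrite /lam /l; case: cid => /= l' [h _]; have [] := h k. Qed.

Let lS k : l (k + 1) = l k \/ l (k + 1) = l k + 1.
Proof. by rewrite /l; case: cid => /= l' [_ h]; exact: h. Qed.

Let lamE j k : l j = l k - 1 -> lam j = 2 * lam k.
Proof.
rewrite /lam => ->; rewrite opprB exprzDr ?unitfE// expr1z//.
Qed.

Let lam_nonincr j k : j <= k -> lam k <= lam j.
Proof.
by move=> /(levels_mono lS) jk; rewrite /lam ler_eXz2l ?ltr1n// lerN2.
Qed.

(** K > 0 makes K < 2 K strict, so a decomposition of cost below 2 K(2^k) exists; this is the factor
    2 in [nF0] and [nF1]. *)
Let decomposition k : exists F : V * V, [/\ carrier X0 F.1, carrier X1 F.2,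
  f = F.1 + F.2 & nrm X0 F.1 + 2 ^ k * nrm X1 F.2 <= 2 * (2 ^ k * psi k)].
Proof.
have [|f0 [f1 [Xf0 Xf1 fE h]]] :=
  @Kfun_decomposition _ _ X0 X1 (2 ^ k) f (2 * Kval X0 X1 f (2 ^ k)).
  by rewrite -KvE// lte_fin ltr_pMl ?K_gt0// ltr1n.
by exists (f0, f1); split => //=; rewrite scale_psi ltW.
Qed.

Let F k := sval (cid (decomposition k)).

Let FP k : [/\ carrier X0 (F k).1, carrier X1 (F k).2,
  f = (F k).1 + (F k).2 & nrm X0 (F k).1 + 2 ^ k * nrm X1 (F k).2 <=
    2 * (2 ^ k * psi k)].
Proof. by rewrite /F; case: cid. Qed.

Let XF0 k : carrier X0 (F k).1. Proof. by have [] := FP k. Qed.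
Let XF1 k : carrier X1 (F k).2. Proof. by have [] := FP k. Qed.
Let FE k : f = (F k).1 + (F k).2. Proof. by have [] := FP k. Qed.

Let nF0 k : nrm X0 (F k).1 <= 2 * (2 ^ k * psi k).
Proof.
have [_ _ _] := FP k; by apply: le_trans; rewrite lerDl mulr_ge0 ?nrm_ge0.
Qed.

Let nF1 k : nrm X1 (F k).2 <= 2 * psi k.
Proof.
have [_ _ _ h] := FP k; rewrite -(ler_pM2l (exp2_gt0 k)) [leRHS]mulrCA.
by apply: le_trans h; rewrite lerDr nrm_ge0.
Qed.

Let jump k := l (k + 1) = l k + 1.

(* The X0-part of f at the unique scale where the level passes from m to m + 1,
   and 0 if there is none, i.e. below the lowest level. *)
Let P (m : int) : V := xget 0 [set v | exists k, [/\ l k = m, jump k & v = (F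
  k).1]].

Let P_jump k : jump k -> P (l k) = (F k).1.
Proof.
move=> jk; rewrite /P; apply: xget_unique; first by exists k.
move=> _ [j [lj jj ->]]; congr (F _).1.
exact: (level_crossing_uniq lS).
Qed.

Let P_none m : (forall k, l k = m -> ~ jump k) -> P m = 0.
Proof.
by move=> h; rewrite /P; apply: xgetPN => _ [k [lk jk _]]; exact: (h k).
Qed.

(** In effect the sum of the u_j with j < k: the A_0-part taken at the jump that entered the current
    level. That jump sits at level l k - 1, hence the shift; a jump at k itself only shows in g (k +
    1). *)
Let g k := P (l k - 1).
Let u k := g (k + 1) - g k.

Let uN k : ~ jump k -> u k = 0.
Proof.
by move=> jk; rewrite /u /g; have [->|//] := lS k; rewrite subrr.
Qed.

Let g_jump j k : l j = l k - 1 -> jump j -> g k = (F j).1.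
Proof. by move=> ljk jj; rewrite /g -ljk P_jump. Qed.

Let u_jump k : jump k -> u k = (F k).1 - g k.
Proof.
by move=> jk; rewrite /u; congr (_ - _); apply: g_jump => //; rewrite jk addrK.
Qed.

(** If a lower level occurs before k, the crossing from l k - 1 to l k is the preceding jump.
    Otherwise l is constant on all scales up to k and [P] returns its default 0. *)
Let g_cases k : (exists j, [/\ j < k, l j = l k - 1, jump j & g k = (F j).1]) \/
  (g k = 0 /\ forall j, j <= k -> l j = l k).
Proof.
have [[j [lj jj]]|h] := pselect (exists j, l j = l k - 1 /\ jump j).
  left; exists j; split => //; last exact: g_jump.
  by rewrite ltNge; apply/negP => /(levels_mono lS); rewrite lj; lia.
right; split.
  by apply: P_none => j lj jj; apply: h; exists j.
move=> j jk; apply/eqP; rewrite eq_le (levels_mono lS)//= leNgt; apply/negP.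
move=> /(level_crossing lS)[i [_ _ li li1]]; apply: h; exists i; split => //.
by rewrite /jump li1 li subrK.
Qed.

Let Xg k : carrier X0 (g k).
Proof.
by have [[j [_ _ _ ->]]|[-> _]] := g_cases k; [exact: XF0|exact: carrier0].
Qed.

Let scale_psi_le j k : j <= k -> 2 ^ j * psi j <= 2 ^ k * psi k.
Proof.
by move=> jk; rewrite !scale_psi; apply: le_Kval => //; rewrite ler_eXz2l ?ltr1n.
Qed.

Let ng k : nrm X0 (g k) <= 2 * (2 ^ k * psi k).
Proof.
have [[j [jk _ _ ->]]|[-> _]] := g_cases k.
  by apply: (le_trans (nF0 j)); rewrite ler_pM2l// scale_psi_le// ltW.
by rewrite nrm0// scale_psi mulr_ge0// ltW// K_gt0.
Qed.

Let scale_lam_gt0 k : 0 < 2 ^ k * lam k. Proof. exact: mulr_gt0. Qed.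

Let nu0 k : jump k -> carrier X0 (u k) /\ nrm X0 (u k) <= 4 * (2 ^ k * lam k).
Proof.
move=> jk; rewrite u_jump//; split; first exact: carrierB.
apply: (le_trans (ler_nrmB _ _ _)) => //.
have : 2 ^ k * psi k <= 2 ^ k * lam k by rewrite ler_pM2l.
by have := nF0 k; have := ng k; lra.
Qed.

(* No bound in X1 on the X0-part of f is available here, only approximations of
   it by X1-parts of f: this is why the completion is needed. *)
Let lowest_jump k : (forall j, j <= k -> l j = l k) ->
  approximations X0 X1 X1 (F k).1 (fun n => (F (k - n%:Z)).2 - (F k).2) /\
  forall n, nrm X1 ((F (k - n%:Z)).2 - (F k).2) <= 6 * lam k.
Proof.
move=> low; have bound n : nrm X1 ((F (k - n%:Z)).2 - (F k).2) <= 6 * lam k.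
  apply: (le_trans (ler_nrmB _ _ _)) => //.
  have : lam (k - n%:Z) = lam k by rewrite /lam low//; lia.
  have := nF1 (k - n%:Z); have := nF1 k; have := psi_lam k.
  by have := psi_lam (k - n%:Z); have := lam_gt0 k; lra.
split=> //; split; [by move=> n; exact: carrierB|by exists (6 * lam k)|].
apply: cvge0P => [n|e e0]; first exact: Kfun_ge0.
have [N hN] := exists_exprn_gt (2 * (2 ^ k * lam k) / e).
exists N => // n /= Nn.
(* Both scales decompose the same f, so the error is minus an A_0-part. Its norm is at most 2
   2^(k-n) lam_k, the level being constant below k, and tends to 0. *)
have -> : (F (k - n%:Z)).2 - (F k).2 - (F k).1 = - (F (k - n%:Z)).1.
  by rewrite -addrA -opprD [X in _ - X]addrC -FE [X in _ - X](FE (k - n%:Z))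
    opprD addrCA subrr addr0.
apply: le_trans (Kfun_le0 _ _ _) _ => //; first exact: carrierN.
rewrite nrmN// lee_fin; apply: (le_trans (nF0 _)).
have lamn : lam (k - n%:Z) = lam k by rewrite /lam low//; lia.
apply: (@le_trans _ _ (2 * (2 ^ (k - n%:Z) * lam k))).
  by rewrite ler_pM2l// ler_pM2l// -lamn.
have -> : 2 ^ (k - n%:Z) = 2 ^ k / 2 ^+ n :> R by rewrite exprzDr ?unitfE// exp2N.
have -> : 2 * (2 ^ k / 2 ^+ n * lam k) = 2 * (2 ^ k * lam k) / 2 ^+ n by ring.
rewrite ler_pdivrMr ?exprn_gt0// [leRHS]mulrC -ler_pdivrMr//.
apply: le_trans (ltW hN) _.
by rewrite ler_eXn2l ?ltr1n.
Qed.

(** With a preceding jump j, u_k is also a difference of A_1-parts, as both decompositions sum to f,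
    and 2 lam_j + 2 lam_k = 6 lam_k. Without one, u_k is the A_0-part itself, controlled by the
    approximating sequence of [lowest_jump]. *)
Let nu1 k : jump k -> carrier G1 (u k) /\ nrm G1 (u k) <= 6 * lam k.
Proof.
move=> jk; have [[j [jltk lj jj gj]]|[g0 low]] := g_cases k.
  have uE : u k = (F j).2 - (F k).2.
    rewrite u_jump// gj; apply/eqP; rewrite subr_eq addrAC -subr_eq opprK.
    by rewrite -FE addrC -FE.
  have Xu : carrier X1 (u k) by rewrite uE; exact: carrierB.
  have [Gu le_u] := sub_gagliardo sn0 sn1 sn1 X1S Xu.
  split => //; apply: (le_trans le_u); rewrite uE.
  apply: (le_trans (ler_nrmB _ _ _)) => //.
  have := lamE lj; have := nF1 j; have := nF1 k; have := psi_lam k.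
  by have := psi_lam j; lra.
have [ap bd] := lowest_jump low.
rewrite u_jump// g0 subr0; split; last exact: (gagliardo_le sn1 ap bd).
by split; [exact: X0S|eexists; exact: ap].
Qed.

Let G_zero : [/\ carrier G0 0, carrier G1 0, nrm G0 0 = 0 & nrm G1 0 = 0].
Proof.
have [? h0] := sub_gagliardo sn0 sn1 sn0 X0S (carrier0 sn0).
have [? h1] := sub_gagliardo sn0 sn1 sn1 X1S (carrier0 sn1).
split => //; apply/eqP; rewrite eq_le gagliardo_ge0// andbT.
  by rewrite -(nrm0 sn0).
by rewrite -(nrm0 sn1).
Qed.

Let Gu k : carrier G0 (u k) /\ carrier G1 (u k).
Proof.
have [jk|/uN ->] := pselect (jump k); last by have [] := G_zero.
split; last exact: (nu1 jk).1.
exact: (sub_gagliardo sn0 sn1 sn0 X0S (nu0 jk).1).1.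
Qed.

Let J_jump k : jump k -> J k (u k) <= 6 * (2 ^ k * lam k).
Proof.
move=> jk; rewrite /Jfun ge_max; apply/andP; split.
  apply: le_trans (sub_gagliardo sn0 sn1 sn0 X0S (nu0 jk).1).2 _.
  by have := (nu0 jk).2; have := scale_lam_gt0 k; lra.
by rewrite mulrCA ler_pM2l//; exact: (nu1 jk).2.
Qed.

Let J_none k : ~ jump k -> J k (u k) = 0.
Proof.
by move=> /uN ->; have [_ _ h0 h1] := G_zero; rewrite /Jfun h0 h1 mulr0 maxxx.
Qed.

Let partial_sumE m n : two_sided_partial_sum u (m.+1, n) = g n - g (- m%:Z).
Proof.
rewrite /two_sided_partial_sum/= big_add1/= telescope_nat.
under eq_bigr => k _.
  rewrite /u (_ : - k.+1%:Z + 1 = - k%:Z); last by lia.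
  rewrite (_ : - k.+1%:Z = - k%:Z - 1); last by lia.
  over.
by rewrite telescope_int addrC addrA subrK.
Qed.

Let g_small (e : R) : 0 < e -> exists N : nat, forall m, (N <= m)%N ->
  nrm X0 (g (- m%:Z)) <= e.
Proof.
move=> e0; have [|t t0 Kt] := Kfun_small sn0 sn1 dense0 Sf (e := e / 2).
  by rewrite divr_gt0.
have [N tN] := exists_exprn_gt t^-1.
exists N => m Nm; apply: (le_trans (ng _)).
have : Kval X0 X1 f (2 ^ (- m%:Z)) <= e / 2.
  rewrite -lee_fin; apply: le_trans Kt; rewrite -KvE ?(ltW t0)// lee_fin.
  apply: le_Kval => //.
  rewrite exp2N -[leRHS]invrK lef_pV2 ?posrE ?invr_gt0 ?exprn_gt0//.
  by apply: (le_trans (ltW tN)); rewrite ler_eXn2l ?ltr1n.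
by rewrite scale_psi; lra.
Qed.

Let psi_small (e : R) : 0 < e -> exists N : nat, forall n, (N <= n)%N ->
  psi n <= e.
Proof.
move=> e0; have [t t0 Kt] := Kfun_small_infty sn0 sn1 dense1 Sf e0.
have [N tN] := exists_exprn_gt t.
exists N => n Nn; have tn : t <= 2 ^+ n.
  by apply: (le_trans (ltW tN)); rewrite ler_eXn2l ?ltr1n.
have tn1 : 1 <= 2 ^+ n / t by rewrite ler_pdivlMr// mul1r.
rewrite /psi ler_pdivrMr// -lee_fin KvE//.
have -> : 2 ^ n%:Z = 2 ^+ n / t * t :> R by rewrite divfK// gt_eqF.
apply: (le_trans (Kfun_scale sn0 tn1 (ltW t0) Sf)).
rewrite (_ : e * _ = 2 ^+ n / t * (t * e)); last by ring.
by rewrite [leRHS]EFinM; apply: lee_wpmul2l => //;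
  rewrite lee_fin (le_trans ler01).
Qed.

Let tail_small (e : R) : 0 < e -> exists N : nat, forall n : nat, (N <= n)%N ->
  exists f1, [/\ carrier X1 f1, f = g n + f1 & nrm X1 f1 <= e].
Proof.
(* The bound lam_0 / 2 forces l 0 < l n, so that a jump j precedes n; e / 8 comes from 2 psi_j <= 2
   lam_j = 4 lam_n < 8 psi_n. *)
move=> e0; pose d := Num.min (lam 0 / 2) (e / 8).
have d0 : 0 < d by rewrite lt_min !divr_gt0.
have [N hN] := psi_small d0; exists N => n /hN.
rewrite le_min => /andP[pl pe].
have : l 0 < l n.
  have : lam n < lam 0 by have := lam_psi n; lra.
  by rewrite /lam ltr_eXz2l ?ltr1n// ltrN2.
move=> /(level_crossing lS)[j [_ _ lj lj1]].
have jj : jump j by rewrite /jump lj1 lj subrK.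
exists (F j).2; split => //; first by rewrite (g_jump lj jj).
by have := nF1 j; have := psi_lam j; have := lamE lj; have := lam_psi n; lra.
Qed.

Let u_representation : J_representation G0 G1 f u.
Proof.
split => //; apply: cvge0P.
  by move=> mn; rewrite /sum_norm Kfun_gagliardo//; exact: Kfun_ge0.
move=> e e0; have e2 : 0 < e / 2 by rewrite divr_gt0.
have [M hM] := g_small e2; have [N hN] := tail_small e2.
(* A partial sum whose first bound is [m.+1] stops at g(-m), hence the shift to [M.+1]. *)
exists ([set m | (M.+1 <= m)%N], [set n | (N <= n)%N]).
  by split; [exists M.+1|exists N].
move=> [[|m] n] [/= Mm Nn] //.
have [f1 [Xf1 fE nf1]] := hN n Nn.
rewrite /sum_norm Kfun_gagliardo// partial_sumE.
have -> : f - (g n - g (- m%:Z)) = g (- m%:Z) + f1.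
  by rewrite [X in X - _]fE opprB addrC addrA subrK.
apply: le_trans (Kfun_le _ _ _) _ => //.
by rewrite lee_fin; have := hM m Mm; lra.
Qed.

Context (b : R -> \bar R) (b_sv : slowly_varying b).
Context (q : R) (q0 : 0 < q).
Local Notation mu := (@completed_lebesgue_measure R).
Local Notation w := (sv_pow b q).
Local Notation W t := (sv_integral b q `]0, t[%classic).
Local Notation pos := (`]0%R, +oo[%classic : set (lebesgueType R)).

Let r : R := 1 - 2 `^ (- q).

Let r_gt0 : 0 < r.
Proof. by rewrite subr_gt0 powRN invf_lt1 ?powR_gt0// powR_gt1// ltr1n. Qed.

(** Equal to r lam_k^q at a jump and to 0 elsewhere: it replaces the terms of the sum over jumps by
    increments that telescope. *)
Let D k := lam k `^ q - lam (k + 1) `^ q.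

Let powR_le (x y : R) : 0 <= x -> x <= y -> x `^ q <= y `^ q.
Proof.
move=> x0 xy; apply: ge0_ler_powR; rewrite ?nnegrE// ?(ltW q0)//.
exact: le_trans xy.
Qed.

Let D_ge0 k : 0 <= D k.
Proof. by rewrite subr_ge0 powR_le ?lam_nonincr ?lerDl// ltW. Qed.

Let term_le k :
  (2 ^ k) `^ (- q) * J k (u k) `^ q <= (6 `^ q / r) * D k.
Proof.
have [jk|/J_none ->] := pselect (jump k); last first.
  rewrite powR0 ?mulr0; last by rewrite gt_eqF.
  by rewrite !mulr_ge0 ?powR_ge0 ?invr_ge0// ltW.
have DE : D k = r * lam k `^ q.
  rewrite /D /r mulrBl mul1r; congr (_ - _).
  have -> : lam (k + 1) = 2^-1 * lam k.
    have -> : lam k = 2 * lam (k + 1) by apply: lamE; rewrite jk addrK.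
    by rewrite mulKf.
  by rewrite powRM ?invr_ge0 ?ltW// powRV.
rewrite DE mulrA divfK ?gt_eqF//.
apply: (@le_trans _ _ ((2 ^ k) `^ (- q) * (6 * (2 ^ k * lam k)) `^ q)).
  by rewrite ler_wpM2l ?powR_ge0// powR_le ?J_jump//
    le_max (gagliardo_ge0 X0 X1 sn0).
have e0 := ltW (exp2_gt0 k); have l0 := ltW (lam_gt0 k).
rewrite !powRM ?mulr_ge0// mulrCA; apply: ler_wpM2l; first exact: powR_ge0.
by rewrite mulrA powRN mulVf ?mul1r// gt_eqF// powR_gt0.
Qed.

Let u_size :
  (\esum_(k in [set: int]) (((2 ^ k) `^ (- q) * J k (u k) `^ q)%:E * W (2 ^
    k)%R) <=
   (6 `^ q / r * 2 `^ q)%:E * \int[mu]_(t in pos) (Kdensity X0 X1 b q f t)%:E)%E.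
Proof.
have W0 k : (0 <= W (2 ^ k)%R)%E
  by apply: (@sv_integral_ge0 _ _ b_sv q `]0, 2 ^ k[); exact: lexx.
(* With psi(t) = K(t) / t this is (2 psi(t))^q, a bound for lam_i^q at every scale 2^i > t. *)
pose M t := (2 * (Kval X0 X1 f t / t)) `^ q.
pose c := 6 `^ q / r.
have c0 : 0 < c by rewrite divr_gt0// powR_gt0.
have ME t : 0 < t -> w t / t * M t = 2 `^ q * Kdensity X0 X1 b q f t.
  move=> t0; have K0 := ltW (K_gt0 t0).
  have ti : 0 <= t^-1 by rewrite invr_ge0 ltW.
  rewrite /M /Kdensity !(powRM q) ?mulr_ge0// powRV ?ltW//; ring.
have mM : measurable_fun pos (fun t => (w t / t * M t)%:E).
  suff : measurable_fun pos (fun t => (2 `^ q)%:E * (Kdensity X0 X1 b q f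
    t)%:E)%E.
    apply: eq_measurable_fun => t; rewrite inE/= in_itv/= andbT => t0.
    by rewrite ME// EFinM.
  by apply: measurable_funeM; exact: measurable_Kdensity.
apply: (@le_trans _ _ (\esum_(k in [set: int]) ((c * D k)%:E * W (2 ^ k)%R))%E).
  by apply: le_esum => k _; rewrite lee_wpmul2r// lee_fin term_le.
apply: (@le_trans _ _ (\int[mu]_(t in pos) (w t / t * (c * M t))%:E)%E).
  apply: (esum_sv_primitive_le b_sv (a := fun k => 2 ^ k)).
  - by move=> k; rewrite mulr_ge0// ltW.
  - suff : measurable_fun pos (fun t => c%:E * (w t / t * M t)%:E)%E.
      by apply: eq_measurable_fun => t _; rewrite -EFinM mulrCA.
    exact: measurable_funeM.
  move=> t N t0.
  (* Truncating the levels at [M t] makes the sum over all k telescope. *)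
  have h k : (if t < 2 ^ k then c * D k else 0) <=
      c * (Num.min (lam k `^ q) (M t) - Num.min (lam (k + 1) `^ q) (M t)).
    case: ifPn => tk.
      (* The truncation is inactive when t < 2^k, since lam_i <= lam_k < 2 psi(2^k) <= 2 psi(t). *)
      have lM i : k <= i -> lam i `^ q <= M t.
        move=> ki; apply: powR_le; first exact: ltW.
        apply: (le_trans (lam_nonincr ki)); apply: (le_trans (ltW (lam_psi k))).
        rewrite ler_pM2l// /psi ler_pdivrMr//.
        have k1 : 1 <= 2 ^ k / t by rewrite ler_pdivlMr// mul1r ltW.
        have := Kfun_scale sn0 k1 (ltW t0) Sf.
        rewrite divfK ?gt_eqF// -!KvE ?(ltW t0)// -EFinM lee_fin => /le_trans;
          apply.
        by rewrite mulrC mulrAC mulrA.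
      by rewrite (min_l (lM k (lexx k))) (min_l (lM (k + 1) _)) ?lerDl.
    (* For 2^k <= t nothing is to be bounded except 0, and truncated increments stay nonnegative
       because lam is nonincreasing. *)
    rewrite mulr_ge0 ?(ltW c0)// subr_ge0; apply: le_min2 => //.
    by rewrite powR_le ?lam_nonincr ?lerDl// ltW.
  apply: (@le_trans _ _ (\sum_(0 <= n < N) (c * 
     ((Num.min (lam (Posz n) `^ q) (M t) - Num.min (lam (Posz n + 1) `^ q) (M
       t)) +
      (Num.min (lam (Negz n) `^ q) (M t) - Num.min (lam (Negz n + 1) `^ q) (M
        t)))))).
    by apply: ler_sum => n _; rewrite [leRHS]mulrDr; apply: lerD; exact: h.
  rewrite -mulr_sumr ler_pM2l//.
  apply: (two_sided_telescope (h := fun k => Num.min (lam k `^ q) (M t))).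
  by move=> k; rewrite le_min !powR_ge0/= ge_min lexx orbT.
have mpos : measurable pos by exact: measurable_itv_lebesgueType.
rewrite -ge0_integralZl_EFin.
- rewrite le_eqVlt; apply/orP; left; apply/eqP; apply: eq_integral => t.
  by rewrite inE/= in_itv/= andbT => t0; rewrite -EFinM mulrCA ME// mulrA.
- exact: mpos.
- by move=> t; exact: Kdensity_ge0.
- exact: measurable_Kdensity.
- by rewrite mulr_ge0 ?powR_ge0// ltW.
Qed.

Lemma J_representation_of_positive_K : exists2 u' : int -> V,
  J_representation G0 G1 f u' &
  (\esum_(k in [set: int]) (((2 ^ k) `^ (- q) * J k (u' k) `^ q)%:E * W (2 ^
    k)%R) <=
   (6 `^ q / (1 - 2 `^ (- q)) * 2 `^ q)%:E *
     \int[mu]_(t in pos) (Kdensity X0 X1 b q f t)%:E)%E.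
Proof. by exists u; [exact: u_representation|exact: u_size]. Qed.

End positive_K.

Context (b : R -> \bar R) (b_sv : slowly_varying b).
Context (q : R) (q0 : 0 < q).
Local Notation B := (Lq_primitive q b).

(** K(1) <= max(1, 1 / t) K(t), so one zero of K makes the norm of f in A_0 + A_1 vanish, and
    convergence of a representation is measured by that norm. *)
Lemma J_representation0 f t : sum_carrier X0 X1 f -> 0 < t ->
  Kval X0 X1 f t = 0 -> J_representation G0 G1 f (fun=> 0).
Proof.
move=> Sf t0 Kt.
have [G00 _] := sub_gagliardo sn0 sn1 sn0 X0S (carrier0 sn0).
have [G10 _] := sub_gagliardo sn0 sn1 sn1 X1S (carrier0 sn1).
split => //; apply: cvge0P.
  by move=> mn; rewrite /sum_norm Kfun_gagliardo//; exact: Kfun_ge0.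
move=> e e0; apply: nearW => mn.
rewrite /two_sided_partial_sum !big1// addr0 subr0 /sum_norm Kfun_gagliardo//.
pose c := Num.max 1 t^-1; have c1 : 1 <= c by rewrite le_max lexx.
apply: (@le_trans _ _ (Kfun X0 X1 (c * t) f)).
  by apply: le_Kfun => //; rewrite -ler_pdivrMr// mul1r le_max lexx orbT.
apply: le_trans (Kfun_scale sn0 c1 (ltW t0) Sf) _.
by rewrite -(KvalE sn0 sn1 Sf (ltW t0)) Kt mule0 lee_fin ltW.
Qed.

Lemma J_size_le_Knorm : exists2 c : R, 0 < c & forall f,
  sum_carrier X0 X1 f -> exists2 u, J_representation G0 G1 f u &
  (J_size G0 G1 q B u <= c%:E * Knorm X0 X1 q b f)%E.
Proof.
pose c : R := 6 `^ q / (1 - 2 `^ (- q)) * 2 `^ q.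
have c0 : 0 < c.
  rewrite mulr_gt0 ?divr_gt0 ?powR_gt0// subr_gt0 powRN invf_lt1 ?powR_gt0//.
  by rewrite powR_gt1// ltr1n.
exists (c `^ q^-1); first exact: powR_gt0.
move=> f Sf; have [K0|] := pselect (forall t, 0 < t -> 0 < Kval X0 X1 f t).
  have [u Ju uc] := J_representation_of_positive_K Sf K0 b_sv q0.
  exists u => //; rewrite J_sizeE// (KnormE sn0 sn1 b_sv)//.
  have I0 : (0 <= \int[completed_lebesgue_measure]_(t in (`]0%R, +oo[%classic :
    set (lebesgueType R)))
      (Kdensity X0 X1 b q f t)%:E)%E.
    by apply: integral_ge0 => t; exact: Kdensity_ge0.
  rewrite -poweR_EFin -poweRM ?lee_fin ?(ltW c0)//; apply: le_poweR => //.
    by rewrite invr_ge0 ltW.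
  apply: esum_ge0 => k _; rewrite mule_ge0 ?lee_fin ?mulr_ge0 ?powR_ge0//.
  by apply: (@sv_integral_ge0 _ _ b_sv q `]0, 2 ^ k[); exact: lexx.
move=> /existsNP[t /not_implyP[t0 /negP]]; rewrite -leNgt => Kt0.
have Kt : Kval X0 X1 f t = 0.
  by apply/eqP; rewrite eq_le Kt0/= Kval_ge0// ltW.
exists (fun=> 0); first exact: J_representation0 Sf t0 Kt.
have -> : J_size G0 G1 q B (fun=> 0) = 0%E.
  have [_ h0] := sub_gagliardo sn0 sn1 sn0 X0S (carrier0 sn0).
  have [_ h1] := sub_gagliardo sn0 sn1 sn1 X1S (carrier0 sn1).
  have n0 : nrm G0 0 = 0.
    by apply/eqP; rewrite eq_le gagliardo_ge0// andbT -(nrm0 sn0).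
  have n1 : nrm G1 0 = 0.
    by apply/eqP; rewrite eq_le gagliardo_ge0// andbT -(nrm0 sn1).
  rewrite /J_size esum1 ?poweR0r ?invr_eq0 ?gt_eqF// => k _.
  by rewrite /Jfun n0 n1 mulr0 maxxx mule0 poweR0r// gt_eqF.
by rewrite mule_ge0 ?lee_fin ?powR_ge0// Lnorm_ge0.
Qed.

End K_to_J.

(** * Banach spaces embedded in V, and the theorem *)

Section embedded_theory.
Context {R : realType} {V : topologicalLmodType R} {A : completeNormedModType R}.
Context (i : {linear A -> V}) (i_inj : injective i).

Lemma nrm_embedded a : nrm (embedded i) (i a) = `|a|.
Proof.
rewrite /= (_ : i @^-1` [set i a] = [set a]) ?image_set1 ?inf1//.
by apply/seteqP; split => [x /= /i_inj|x ->].
Qed.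

Lemma embedded_seminormed : is_seminormed (embedded i).
Proof.
split.
- by exists 0; rewrite ?linear0.
- by move=> _ _ [x _ <-] [y _ <-]; exists (x - y); rewrite ?linearB.
- by rewrite -(linear0 i) nrm_embedded normr0.
- move=> v; have [v0|/set0P v0] := eqVneq (i @^-1` [set v]) set0.
    by rewrite /= v0 image_set0 inf0.
  by apply: lb_le_inf => [|_ [a _ <-]]; [exact: image_nonempty|].
- by move=> _ _ [x _ <-] [y _ <-]; rewrite -linearB !nrm_embedded ler_normB.
Qed.

Lemma embedded_dense (S : set V) : dense (i @^-1` S) ->
  forall v (e : R), carrier (embedded i) v -> 0 < e ->
  exists2 a, S (i a) & nrm (embedded i) (v - i a) < e.
Proof.
move=> dS _ e [x _ <-] e0.
have [||a [xa Sa]] := dS (ball x e).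
- by exists x; exact: ballxx.
- exact: ball_open.
by exists a => //; rewrite -linearB nrm_embedded; move: xa; rewrite -ball_normE.
Qed.

End embedded_theory.

Theorem theorem3p7 (R : realType) (V : topologicalLmodType R)
    (A0 A1 : completeNormedModType R)
    (i0 : {linear A0 -> V}) (i1 : {linear A1 -> V})
    (couple : banach_couple i0 i1) (regular : regular_couple i0 i1)
    (q : R) (q_gt0 : 0 < q) (q_le1 : q <= 1)
    (b : R -> \bar R) (b_sv : slowly_varying b)
    (b_fin : (Lq_norm q `]0%R, 1%R[ (fun t => (t `^ (- q^-1))%:E * b t)
              < +oo)%E) :
  let X0 := embedded i0 in
  let X1 := embedded i1 in
  let B := Lq_primitive q b in
  slowly_varying B /\
  same_space_equiv_norms
    (K_space X0 X1 q b)
    (J_space (gagliardo X0 X1 X0) (gagliardo X0 X1 X1) q B).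
Proof.
move=> X0 X1 B; split; first exact: slowly_varying_Lq_primitive.
have sn0 : is_seminormed X0 by exact: (embedded_seminormed (couple_inj0 couple)).
have sn1 : is_seminormed X1 by exact: (embedded_seminormed (couple_inj1 couple)).
have [d0 d1] := regular.
have dense0 f (e : R) : carrier X0 f -> 0 < e ->
    exists g, [/\ carrier X0 g, carrier X1 g & nrm X0 (f - g) < e].
  move=> Xf /(embedded_dense (couple_inj0 couple) d0 Xf)[a ia ae].
  by exists (i0 a); split => //; exists a.
have dense1 f (e : R) : carrier X1 f -> 0 < e ->
    exists g, [/\ carrier X0 g, carrier X1 g & nrm X1 (f - g) < e].
  move=> Xf /(embedded_dense (couple_inj1 couple) d1 Xf)[a ia ae].
  by exists (i1 a); split => //; exists a.
set G0 := gagliardo X0 X1 X0; set G1 := gagliardo X0 X1 X1.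
have SE : sum_carrier G0 G1 = sum_carrier X0 X1 by exact: sum_carrier_gagliardo.
have [c c0 KJ] := Knorm_le_J_size sn0 sn1 b_sv q_gt0 q_le1.
have [d d0' JK] := J_size_le_Knorm sn0 sn1 dense0 dense1 b_sv q_gt0.
have Kinf f : sum_carrier X0 X1 f -> (Knorm X0 X1 q b f <=
    c%:E * ereal_inf [set J_size G0 G1 q B u | u in J_representation G0 G1 f])%E.
  (* Dividing by c frees the infimum, so that each representation can be treated separately. *)
  move=> Sf; rewrite -lee_pdivrMl//; apply: le_ereal_inf_tmp => _ [u Ju <-].
  by rewrite lee_pdivrMl//; exact: KJ.
have infK f : sum_carrier X0 X1 f ->
    (ereal_inf [set J_size G0 G1 q B u | u in J_representation G0 G1 f] <=
     d%:E * Knorm X0 X1 q b f)%E.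
  move=> Sf; have [u Ju uK] := JK f Sf; apply: le_trans uK.
  by apply: ereal_inf_lbound; exists u.
have K0 f : (0 <= Knorm X0 X1 q b f)%E by exact: Lnorm_ge0.
have inf0 f : (0 <= ereal_inf [set J_size G0 G1 q B u | u in J_representation
  G0 G1 f])%E.
  by apply: le_ereal_inf_tmp => _ [u _ <-]; exact: poweR_ge0.
split.
  apply/seteqP; split => f /=; rewrite SE => -[Sf].
    move=> Kf; split => //; have [u Ju uK] := JK f Sf; exists u => //.
    by apply: le_lt_trans uK _; rewrite lte_mul_pinfty// lee_fin ltW.
  move=> [u Ju uy]; split => //; apply: le_lt_trans (KJ f u Sf Ju) _.
  by rewrite lte_mul_pinfty ?lee_fin ?(ltW c0)// poweR_ge0.
exists (c + d); first by rewrite addr_gt0.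
move=> f [Sf Kf] /=.
(* The norms are compared through [fine], which requires finiteness: by membership on the K side, by
   [infK] on the J side. *)
have Kfin : Knorm X0 X1 q b f \is a fin_num by rewrite ge0_fin_numE.
have inffin : ereal_inf [set J_size G0 G1 q B u | u in J_representation G0 G1 f]
    \is a fin_num.
  rewrite ge0_fin_numE//; apply: le_lt_trans (infK f Sf) _.
  by rewrite lte_mul_pinfty// lee_fin ltW.
have := Kinf f Sf; have := infK f Sf.
rewrite -(fineK Kfin) -(fineK inffin) -!EFinM !lee_fin /= => h1 h2.
have k0 : 0 <= fine (Knorm X0 X1 q b f) by rewrite fine_ge0.
have i0' := fine_ge0 (inf0 f).
split.
  by apply: (le_trans h2); rewrite ler_wpM2r// lerDl ltW.
by apply: (le_trans h1); rewrite ler_wpM2r// lerDr ltW.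
Qed.
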